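(* Assume the Continuum Hypothesis ($2^{\aleph_0}=\aleph_1$). Then there is a compact subspace $K\subseteq 2^{\omega_1}$ (where $2^{\omega_1}=\{0,1\}^{\omega_1}$ has the product topology) with all of the following properties: \begin{itemize} \item $K$ is not metrizable, but $K$ is a 2-to-1 continuous preimage of a metric space; \item $K$ is hereditarily separable and hereditarily Lindel\''of; \item every Radon measure on $K$ is separable; \item $K$ has no isolated points; \item $K$ is not Rosenthal compact; \item every uncountable nice semi-biorthogonal sequence in $C(K)$ is $\omega$-determined. \end{itemize}
   Context: All spaces are Hausdorff. $C(K)$ is the real Banach space of continuous real-valued functions on the compact space $K$ with the supremum norm, and $C(K)^\ast$ is its dual. For $x\in K$, $\delta_x\in C(K)^\ast$ is the Dirac measure at $x$, i.e. $\delta_x(f)=f(x)$. 2-to-1 continuous preimage: $K$ is a 2-to-1 continuous preimage of a metric space $M$ if there is a continuous surjection $K\to M$ all of whose fibres have at most two points. Separable measure: a (finite) Radon measure $\mu$ on $K$ is separable if $L^1(\mu)$ is a separable Banach space. Rosenthal compact: a compact space is Rosenthal compact if it is homeomorphic to a compact subset, in the topology of pointwise convergence, of the space of real-valued Baire class 1 functions on some Polish space. Semi-biorthogonal sequence: for a Banach space $X$ and an ordinal $\alpha^\ast$, a sequence $\langle (f_\alpha,\varphi_\alpha):\alpha<\alpha^\ast\rangle$ in $X\times X^\ast$ is semi-biorthogonal if for all $\alpha,\beta<\alpha^\ast$: $\varphi_\alpha(f_\alpha)=1$; $\varphi_\alpha(f_\beta)=0$ if $\beta<\alpha$; and $\varphi_\alpha(f_\beta)\ge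 0$ if $\beta>\alpha$. It is uncountable if $\alpha^\ast$ is uncountable. Nice: a semi-biorthogonal sequence $\langle (f_\alpha,\varphi_\alpha):\alpha<\alpha^\ast\rangle$ in $C(K)\times C(K)^\ast$ (called a semi-biorthogonal sequence in $C(K)$) is nice if there are points $x^0_\alpha,x^1_\alpha\in K$ ($\alpha<\alpha^\ast$) such that $\varphi_\alpha=\delta_{x^1_\alpha}-\delta_{x^0_\alpha}$ for every $\alpha<\alpha^\ast$. $\omega$-determined: for $K\subseteq 2^{\omega_1}$, a nice semi-biorthogonal sequence $\langle (f_\alpha,\delta_{x^1_\alpha}-\delta_{x^0_\alpha}):\alpha<\alpha^\ast\rangle$ in $C(K)$ is $\omega$-determined if for every $s\in 2^\omega$ the set $\{\alpha<\alpha^\ast: x^0_\alpha\upharpoonright\omega=x^1_\alpha\upharpoonright\omega=s\}$ is countable. *)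

(* Defs.v *)
From HB Require Import structures.
From mathcomp Require Import all_boot all_order all_algebra.
From mathcomp Require Import wochoice all_classical all_reals all_analysis.
Set Implicit Arguments.
Unset Strict Implicit.
Unset Printing Implicit Defensive.
Import Order.TTheory GRing.Theory Num.Theory.
Import numFieldNormedType.Exports.
Local Open Scope classical_set_scope.
Local Open Scope card_scope.
Local Open Scope ring_scope.

(* Ordinals are represented by types equipped with a (reflexive) well-order
   [le] in the sense of [wochoice.well_order]. *)
Section Ordinals.
Context {A : Type} (le : rel A).

Definition olt (a b : A) : Prop := le a b /\ a <> b.

Definition is_omega1 : Prop :=
  [/\ well_order le,
      ~ countable [set: A] &
      forall a, countable [set b | olt b a]].

(* The element [a] is the [n]-th one, i.e. it corresponds to the finite
   ordinal [n]. *)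
Definition is_nth (n : nat) (a : A) : Prop := [set b | olt b a] #= `I_n.

(* x |` omega = s, for x in 2^A and s in 2^omega. *)
Definition restr_omega (x : A -> bool) (s : nat -> bool) : Prop :=
  forall n a, is_nth n a -> x a = s n.

End Ordinals.

Lemma nat_bool_uncountable : ~ countable [set: nat -> bool].
Proof.
move=> /countable_injP[f finj].
have {}finj : injective f by move=> x y; apply: finj; rewrite inE.
pose d n := `[< forall g, f g = n -> ~~ g n >].
have := erefl (d (f d)); rewrite {1}/d; case: asboolP => [h | h] e.
- by have := h d erefl; rewrite -e.
- by apply: h => g /finj ->; rewrite -e.
Qed.

(* Non-vacuity of [is_omega1]. *)
Lemma is_omega1_exists : exists (A : Type) (le : rel A), is_omega1 le.
Proof.
have [le wo] := well_ordering_principle (nat -> bool).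
pose big := [pred a | `[< ~ countable [set b | olt le b a] >]].
have [bigP|smallP] := pselect (exists a, a \in big); last first.
  exists (nat -> bool), le; split=> [//||a]; first exact: nat_bool_uncountable.
  by apply: contra_notP smallP => h; exists a; apply/asboolP.
have [m [[/asboolP mbig mmin] _]] := wo _ bigP.
pose B := {b | `[< olt le b m >]}.
have lt_of (x : B) : olt le (val x) m by apply/asboolP/(valP x).
have val_countable (P : set B) : countable P <-> countable (val @` P).
  by rewrite (eq_countable (inj_card_eq _))// => x y _ _; exact: val_inj.
exists B, (fun x y => le (val x) (val y)); split.
- move=> C [c Cc].
  pose D := [pred b | `[< exists2 x : B, x \in C & val x = b >]].
  have [|z [[/asboolP[x xC xz] zmin] zuniq]] := wo D.
    by exists (val c); apply/asboolP; exists c.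
  exists x; split=> [|y [yC ymin]].
    by split=> // y yC; rewrite xz; apply: zmin; apply/asboolP; exists y.
  apply: val_inj; rewrite xz; apply: zuniq; split.
    by apply/asboolP; exists y.
  by move=> _ /asboolP[w wC <-]; exact: ymin.
- apply: contra_not mbig => /val_countable; apply: sub_countable.
  apply: subset_card_le => b bm.
  by exists (exist _ b (asboolT bm)).
- move=> a; apply/val_countable.
  have : countable [set b | olt le b (val a)].
    have [am ame] := lt_of a; apply: contrapT => abig.
    have := mmin (val a) (asboolT abig) => ma.
    have refl x : le x x.
      have [|w [[/eqP <- wmin] _]] := wo (pred1 x); first by exists x; exact: eqxx.
      by apply: wmin; exact: eqxx.
    have [|z [_ zuniq]] := wo (pred2 (val a) m).
      by exists m; rewrite unfold_in /= eqxx orbT.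
    apply: ame; rewrite -(zuniq (val a)) -?(zuniq m)//.
    + split; first by rewrite unfold_in /= eqxx orbT.
      by move=> y /orP[]/eqP->.
    + split; first by rewrite unfold_in /= eqxx.
      by move=> y /orP[]/eqP->.
  apply: sub_countable; apply: subset_card_le => _ [x [xa xna] <-].
  by split=> // /val_inj.
Qed.

(* 2^aleph_0 = aleph_1, where aleph_1 is the cardinality of any type carrying a
   well-order of type omega_1. *)
Definition CH : Prop :=
  forall (A : Type) (le : rel A), is_omega1 le ->
    [set: nat -> bool] #= [set: A].

Section Topology.
Context (R : realType).

Definition homeomorphic (X Y : topologicalType) : Prop :=
  exists (h : X -> Y) (k : Y -> X),
    [/\ continuous h, continuous k, cancel h k & cancel k h].

Definition metrizable (X : topologicalType) : Prop :=
  exists M : metricType R, homeomorphic X M.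

Definition two_to_one_preimage_of_metric (X : topologicalType) : Prop :=
  exists (M : metricType R) (p : X -> M),
    [/\ continuous p, range p = [set: M] &
        forall y : M, p @^-1` [set y] #<= `I_2].

Definition separable_space (X : topologicalType) : Prop :=
  exists2 D : set X, countable D & dense D.

Definition lindelof_space (X : topologicalType) : Prop :=
  forall U : set (set X), U `<=` open -> \bigcup_(O in U) O = [set: X] ->
    exists V : set (set X),
      [/\ V `<=` U, countable V & \bigcup_(O in V) O = [set: X]].

Definition hereditarily (P : topologicalType -> Prop) (X : topologicalType) :
  Prop := forall A : set X, P (set_type A).

Definition complete_metric (M : metricType R) : Prop :=
  forall F : set_system M, ProperFilter F -> cauchy F -> exists x : M, F --> x.

Definition polish (X : topologicalType) : Prop :=
  separable_space X /\
  exists2 M : metricType R, complete_metric M & homeomorphic X M.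

Definition baire1 (X : topologicalType) : set {ptws X -> R} :=
  [set f | exists2 g : nat -> X -> R, (forall n, continuous (g n)) &
           forall x, g n x @[n --> \oo] --> f x].

Definition rosenthal_compact (X : topologicalType) : Prop :=
  exists (P : topologicalType) (C : set {ptws P -> R}),
    [/\ polish P, compact C, C `<=` @baire1 P & homeomorphic X (set_type C)].

End Topology.

(* The measurable types of the library are pointed; [pointed_at p] is X with p
   as distinguished point, and [borel_at p] is X with its Borel sigma-algebra. *)
Definition pointed_at (X : topologicalType) (p : X) : Type := X.
HB.instance Definition _ (X : topologicalType) (p : X) :=
  Topological.on (pointed_at p).
HB.instance Definition _ (X : topologicalType) (p : X) :=
  isPointed.Build (pointed_at p) p.

Notation borel_at p :=
  (g_sigma_algebraType (@open (pointed_at p) : set (set (pointed_at p)))).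

Section Measures.
Context (R : realType).

Definition radon (X : topologicalType) (p : X)
    (mu : {finite_measure set (borel_at p) -> \bar R}) : Prop :=
  forall B : set (borel_at p), measurable B ->
    mu B = ereal_sup [set mu C | C in [set C | compact (C : set X) /\ C `<=` B]].

Definition separable_measure d (T : measurableType d)
    (mu : {measure set T -> \bar R}) : Prop :=
  exists2 D : set (LspaceType1 mu), countable D &
    forall (f : LspaceType1 mu) (e : R), 0 < e ->
      exists2 g, D g & ('N[mu]_1[EFin \o (f \- g)%R] < e%:E)%E.

Definition all_radon_separable (X : topologicalType) : Prop :=
  forall (p : X) (mu : {finite_measure set (borel_at p) -> \bar R}),
    radon mu -> separable_measure mu.

End Measures.

Definition continuous_functions (R : realType) (X : topologicalType) :
  {pred X -> R} := mem [set f : X -> R | continuous f].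

Section ContinuousFunctions.
Context (R : realType) (X : topologicalType).

Lemma cont_fun_submod_closed :
  submod_closed (@continuous_functions R X).
Proof.
split=> [|a f g]; first by apply/mem_set => x; exact: cvg_cst.
move=> /set_mem cf /set_mem cg; apply/mem_set => x.
exact: (@cvgD _ R _ (nbhs x) _ _ _ _ _ (cvgM (cvg_cst a) (cf x)) (cg x)).
Qed.

HB.instance Definition _ :=
  GRing.isSubmodClosed.Build _ _ (@continuous_functions R X)
    cont_fun_submod_closed.

(* The Banach space C(X) with the sup norm.  The compactness proof is a
   parameter of the type because the norm is only a norm for compact X. *)
Record Cspace (cX : compact [set: X]) : Type :=
  mkCspace { Cfun :> X -> R ; _ : Cfun \in @continuous_functions R X }.

Context (cX : compact [set: X]).
Local Notation C := (Cspace cX).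
Local Notation val := (@Cfun cX).

HB.instance Definition _ := [isSub of C for val].
HB.instance Definition _ := [Choice of C by <:].
HB.instance Definition _ := [SubChoice_isSubLmodule of C by <:].

Lemma Cspace_continuous (f : C) : continuous f.
Proof. exact: set_mem (valP f). Qed.


Let nm (f : C) : R := sup (range (fun x => `|f x|)).

Lemma Cspace_bounded (f : C) : has_ubound (range (fun x => `|f x|)).
Proof.
have := continuous_compact (continuous_subspaceT (@Cspace_continuous f)) cX.
move=> /compact_bounded[M [_ /(_ (M + 1))]]; rewrite ltrDl ltr01 => /(_ isT) h.
by exists (M + 1) => _ [x _ <-]; apply: h; exists x.
Qed.

Lemma nm_ub (f : C) x : `|f x| <= nm f.
Proof. by apply: ub_le_sup; [exact: Cspace_bounded|exists x]. Qed.

Lemma nm_le (f : C) (e : R) : 0 <= e -> (forall x, `|f x| <= e) -> nm f <= e.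
Proof.
move=> e0 fe; have [[x]|X0] := pselect (exists x : X, True).
  by move=> _; apply: ge_sup => [|_ [y _ <-]]; [exists `|f x|, x|exact: fe].
rewrite /nm; have -> : range (fun x => `|f x|) = set0.
  by rewrite -subset0 => y [x _ _]; apply: X0; exists x.
by rewrite sup0.
Qed.

Lemma nm_ge0 (f : C) : 0 <= nm f.
Proof.
have [[x _]|X0] := pselect (exists x : X, True).
  exact: le_trans (nm_ub f x).
rewrite /nm; have -> : range (fun x => `|f x|) = set0.
  by rewrite -subset0 => y [x _ _]; apply: X0; exists x.
by rewrite sup0.
Qed.

Lemma nmD (f g : C) : nm (f + g) <= nm f + nm g.
Proof.
apply: nm_le => [|x]; first by rewrite addr_ge0 ?nm_ge0.
by rewrite (le_trans (ler_normD _ _))// lerD ?nm_ub.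
Qed.

Lemma nmZ_le (a : R) (f : C) : nm (a *: f) <= `|a| * nm f.
Proof.
apply: nm_le => [|x]; first by rewrite mulr_ge0 ?nm_ge0.
by rewrite [`|_|]normrM ler_wpM2l ?nm_ub.
Qed.

Lemma nmZ (a : R) (f : C) : nm (a *: f) = `|a| * nm f.
Proof.
apply/eqP; rewrite eq_le nmZ_le /=; have [->|a0] := eqVneq a 0.
  by rewrite normr0 mul0r nm_ge0.
have := nmZ_le a^-1 (a *: f); rewrite scalerA mulVf// scale1r normfV.
by rewrite ler_pdivlMl ?normr_gt0.
Qed.

Lemma nm0_eq0 (f : C) : nm f = 0 -> f = 0.
Proof.
move=> f0; apply/val_inj/funext => x; apply/eqP; rewrite -normr_le0 -f0.
exact: nm_ub.
Qed.

HB.instance Definition _ := Lmodule_isNormed.Build R C nmD nmZ nm0_eq0.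

Lemma Cspace_normE (f : C) : `|f| = sup (range (fun x => `|f x|)).
Proof. by []. Qed.

Lemma Cspace_complete (F : set_system C) : ProperFilter F -> cauchy F -> cvg F.
Proof.
move=> FF /cauchy_ballP Fc.
have normlt (f g : C) e : ball f e g -> forall x, `|f x - g x| < e.
  rewrite -ball_normE /= => + x; apply: le_lt_trans.
  exact: (nm_ub (f - g) x).
pose ev (x : X) (f : C) : R := f x.
have cvx x : cvg (ev x @ F).
  apply: cauchy_cvg; apply/cauchy_ballP => e e0.
  have [[A B] /= [FA FB] AB] := Fc _ e0.
  exists (ev x @` A, ev x @` B) => /=.
    by split; [apply: filterS FA => f Af; exists f|
               apply: filterS FB => f Bf; exists f].
  move=> [_ _] /= [[f Af <-] [g Bg <-]].
  by rewrite -ball_normE; apply: normlt; exact: (AB (f, g)).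
pose l x : R := lim (ev x @ F).
have unif e : 0 < e -> F [set f : C | forall x, `|l x - f x| <= e].
  move=> e0; have [[A B] /= [FA FB] AB] := Fc _ e0.
  apply: filterS FB => g Bg x; apply/ler_addgt0Pr => d d0.
  have /cvgrPdist_lt/(_ _ d0) Fd := cvx x.
  have [f [Af fd]] := filter_ex (filterI FA Fd).
  rewrite (le_trans (ler_distD (f x) _ _))// addrC lerD//; last exact: ltW.
  by apply/ltW/normlt; exact: (AB (f, g)).
have cl : continuous l.
  apply: (@uniform_limit_continuous _ _ (val @ F)).
    exact: nearW Cspace_continuous.
  move=> P /uniform_nbhs[E [/= + EP]].
  rewrite -entourage_ballE => -[e /= e0 eE].
  have e20 : 0 < e / 2 by rewrite divr_gt0.
  apply: filterS (unif _ e20) => f lf; apply: EP => y _; apply: eE.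
  rewrite /= -ball_normE /=; apply: le_lt_trans (lf y) _.
  by rewrite ltr_pdivrMr// ltr_pMr// ltr1n.
apply/cvg_ex; exists (mkCspace cX (mem_set cl)).
apply/cvgrPdist_le => e e0; apply: filterS (unif _ e0) => f lf.
by apply: nm_le; [exact: ltW|exact: lf].
Qed.
HB.instance Definition _ := Uniform_isComplete.Build C Cspace_complete.

End ContinuousFunctions.

Section SemiBiorthogonal.
Context (R : realType).

Record dual (X : normedModType R) : Type :=
  mkDual { dual_fun :> {linear X -> R} ; dual_continuous : continuous dual_fun }.

Definition semi_biorthogonal (X : completeNormedModType R)
    (A : Type) (le : rel A) (f : A -> X) (phi : A -> dual X) : Prop :=
  [/\ forall a, phi a (f a) = 1,
      forall a b, olt le b a -> phi a (f b) = 0 &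
      forall a b, olt le a b -> 0 <= phi a (f b)].

Context (X : topologicalType) (cX : compact [set: X]).

(* The Dirac measure at x, as a functional on C(X). *)
Definition delta (x : X) : Cspace R cX -> R := fun g => g x.

(* The points x0, x1 witness that the sequence with functionals [phi] is nice.
   When the functionals belong to a semi-biorthogonal sequence, these points are
   uniquely determined by [phi]. *)
Definition nice_witness (A : Type) (phi : A -> dual (Cspace R cX))
    (x0 x1 : A -> X) : Prop :=
  forall a, (phi a : _ -> R) = delta (x1 a) \- delta (x0 a).

End SemiBiorthogonal.

Definition omega_determined (W : Type) (le : rel W) (K : set {ptws W -> bool})
    (A : Type) (x0 x1 : A -> set_type K) : Prop :=
  forall s : nat -> bool,
    countable [set a | restr_omega le (val (x0 a)) s /\
                       restr_omega le (val (x1 a)) s].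

(* Main.v *)
(* The Cantor set 2^omega is resolved at every point: K consists of the pairs
   (t, i) with t in 2^omega and i a bit, and the neighbourhoods of (t, i) are
   { (u, j) : u agrees with t up to n, and P t (Delta u t) = i if u <> t, j = i
   if u = t }, where Delta u t is the first index where u and t differ.  K is
   embedded into 2^{omega_1} by the first omega coordinates (those of t) and by
   one coordinate for the side relative to each point of 2^omega.  The whole
   construction is thus the choice of the subsets P t of omega, and by CH each of
   the following 2^{aleph_0} requirements can be met for all but countably many t:
   - for every sequence S in 2^omega, for all but countably many t to which S
     accumulates, both sides of t contain terms of S arbitrarily close to t;
     this gives hereditary separability, the hereditary Lindeloef property and
     non-metrizability, and shows that an open set is a countable set together
     with a countable union of preimages of cylinders, so that L^1 of a finite
     measure is generated by cylinders and atoms;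
   - a Rosenthal compactum with a marked countable set is coded by a real.  If K
     were represented by Baire 1 functions on a Polish space Y, then P t would be,
     modulo finite sets and complements, the only pattern along which the values
     at dyadic points of a function x |-> x(y) can have two different limits at
     t: the code and t determine P t up to countably many possibilities, which
     are avoided for all but countably many t.
   Two functionals delta_{x1} - delta_{x0} over the same point of 2^omega can
   only differ by the sign, which bounds the sequences over a point by two. *)
Require Import Defs.
From HB Require Import structures.
From mathcomp Require Import all_boot all_order all_algebra.
From mathcomp Require Import wochoice all_classical all_reals all_analysis.
From mathcomp Require Import measurable_realfun hoelder.
Set Implicit Arguments.
Unset Strict Implicit.
Unset Printing Implicit Defensive.
Import Order.TTheory GRing.Theory Num.Theory.
Import numFieldNormedType.Exports.
Local Open Scope classical_set_scope.
Local Open Scope card_scope.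
Local Open Scope ring_scope.

Lemma countableS {T : Type} {A B : set T} :
  A `<=` B -> countable B -> countable A.
Proof. by move=> AB; apply: sub_countable; exact: subset_card_le. Qed.

Lemma countable_image {T U : Type} (f : T -> U) (A : set T) :
  countable A -> countable (f @` A).
Proof. by apply: sub_countable; exact: card_image_le. Qed.

Lemma countable_setU {T : Type} (A B : set T) :
  countable A -> countable B -> countable (A `|` B).
Proof.
move=> cA cB; rewrite -bigcup2E; apply: bigcup_countable => //.
by move=> [|[|i]] _ //=; exact: countable0.
Qed.

Lemma countable_enum {T : Type} (A : set T) : countable A ->
  exists e : nat -> option T, forall x, A x -> exists k, e k = Some x.
Proof.
move=> /countable_injP[f fI].
exists (fun k => if pselect (exists x, A x /\ f x = k) is left h
  then Some (projT1 (cid h)) else None).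
move=> x Ax; exists (f x); case: pselect => [h|]; last by case; exists x.
by case: cid => y /= [Ay fyx]; congr Some; apply: fI; rewrite ?inE.
Qed.

Lemma well_order_total {A : Type} {le : rel A} : well_order le ->
  forall a b, [\/ olt le a b, olt le b a | a = b].
Proof.
move=> wo a b; have [->|ab] := pselect (a = b); first by constructor 3.
have [|z [[/asboolP zab zmin] _]] := wo [pred x | `[< x = a \/ x = b >]].
  by exists a; apply/asboolP; left.
have za : le z a by apply: zmin; apply/asboolP; left.
have zb : le z b by apply: zmin; apply/asboolP; right.
case: zab za zb => -> za zb; [constructor 1|constructor 2]; split => //.
by move/esym.
Qed.

Definition unbounded (J : set nat) : Prop :=
  forall N, exists2 n, (N <= n)%N & J n.

Lemma unboundedT : unbounded setT.
Proof. by move=> N; exists N. Qed.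

Lemma unbounded_subset (I J : set nat) :
  I `<=` J -> unbounded I -> unbounded J.
Proof. by move=> IJ uI N; have [n Nn /IJ] := uI N; exists n. Qed.

Lemma unboundedPn (J : set nat) :
  ~ unbounded J -> exists N, forall n, (N <= n)%N -> ~ J n.
Proof. by move=> /existsNP[N h]; exists N => n Nn Jn; apply: h; exists n. Qed.

Lemma diagonal_sequence (J : nat -> set nat) (B : nat -> nat -> bool) :
  exists P : nat -> bool, forall k, unbounded (J k) ->
    unbounded [set n | J k n /\ P n = B k n].
Proof.
pose nx k m := xget m [set n | (m <= n)%N /\ J k n].
have nxm k m : (m <= nx k m)%N by rewrite /nx; case: xgetP => [_ -> []|].
have nxJ k m : unbounded (J k) -> J k (nx k m).
  move=> /(_ m)[n mn Jn]; rewrite /nx; case: xgetP => [_ -> []//|].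
  by move=> /(_ n)[].
pose kk r := odflt (0, 0)%N (unpickle r) : nat * nat.
pose fix s r : nat :=
  if r is r'.+1 then nx (kk r).1 (maxn (kk r).2 (s r').+1)
  else nx (kk 0%N).1 (kk 0%N).2.
have sS r : (s r < s r.+1)%N.
  by rewrite /=; apply: leq_trans (nxm _ _); rewrite leq_max leqnn orbT.
have sE r : exists2 m, ((kk r).2 <= m)%N & s r = nx (kk r).1 m.
  by case: r => [|r]; [exists (kk 0%N).2|
    exists (maxn (kk r.+1).2 (s r).+1); rewrite ?leq_max ?leqnn].
have sI : injective s.
  have smon : {mono s : m n / (m <= n)%N}.
    exact/leq_mono/(homo_ltn ltn_trans sS).
  exact: incn_inj.
exists (fun n => `[< exists2 r, s r = n & B (kk r).1 n >]) => k uJ N.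
have [r kr] : exists r, kk r = (k, N) by exists (pickle (k, N)); rewrite /kk pickleK.
have [m Nm sr] := sE r; rewrite kr /= in Nm sr.
exists (s r); first by rewrite sr (leq_trans Nm).
split; first by rewrite sr; exact: nxJ.
apply/asboolP/idP => [[r' /sI -> ]|h]; first by rewrite kr.
by exists r => //; rewrite kr.
Qed.

(* Transporting the well-order of type omega_1 to [nat -> bool], it suffices
   that [P t] meets the requirements of the countably many predecessors of [t]. *)
Lemma CH_diagonal (W : Type) (leW : rel W) : is_omega1 leW -> CH ->
  forall (J : (nat -> bool) -> nat -> (nat -> bool) -> set nat)
         (B : (nat -> bool) -> nat -> (nat -> bool) -> nat -> bool),
  exists P : (nat -> bool) -> nat -> bool,
    (forall t b, unbounded [set n | P t n = b]) /\
    forall o, countable [set t | ~ forall k, unbounded (J o k t) ->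
      unbounded [set n | J o k t n /\ P t n = B o k t n]].
Proof.
move=> om1 ch J B; have [wo _ pred_countable] := om1.
have [rk rkI] : exists rk : (nat -> bool) -> W, injective rk.
  have /card_set_bijP[f [_ _ fS]] : [set: W] #= [set: nat -> bool].
    by rewrite card_eq_sym; exact: ch om1.
  have /choice[rk rkK] (t : nat -> bool) : exists w, f w = t.
    by have [w _ <-] := fS t I; exists w.
  by exists rk; exact: can_inj rkK.
have ctb (t : nat -> bool) : countable [set o | olt leW (rk o) (rk t)].
  move: (pred_countable (rk t)) => /countable_injP[f fI].
  apply/countable_injP; exists (f \o rk) => x y; rewrite !inE => xt yt /= fxy.
  by apply: rkI; apply: fI; rewrite ?inE.
have /choice[P PP] : forall t, exists p : nat -> bool,
    (forall b, unbounded [set n | p n = b]) /\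
    forall o, olt leW (rk o) (rk t) -> forall k, unbounded (J o k t) ->
      unbounded [set n | J o k t n /\ p n = B o k t n].
  move=> t; have [e eP] := countable_enum (ctb t).
  pose J' (j : nat) : set nat :=
    match unpickle j : option (bool + nat * nat) with
    | Some (inl b) => setT
    | Some (inr (i, k)) => if e i is Some o then J o k t else set0
    | None => set0 end.
  pose B' (j : nat) : nat -> bool :=
    match unpickle j : option (bool + nat * nat) with
    | Some (inl b) => fun=> b
    | Some (inr (i, k)) => if e i is Some o then B o k t else fun=> true
    | None => fun=> true end.
  have [p pP] := diagonal_sequence J' B'.
  exists p; split=> [b|o /eP[i ei] k uJ].
    have := pP (pickle (inl b : bool + nat * nat)).
    rewrite /J' /B' pickleK => /(_ unboundedT).
    by apply: unbounded_subset => n [].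
  have := pP (pickle (inr (i, k) : bool + nat * nat)).
  by rewrite /J' /B' pickleK ei; exact.
exists P; split=> [t b|o]; first exact: (PP t).1.
have : countable ([set t | olt leW (rk t) (rk o)] `|` [set o]).
  by apply: countable_setU => //; exact: countable1.
apply: countableS => t; have := well_order_total wo (rk o) (rk t).
case=> [/(PP t).2 h []//|to _|/rkI -> _]; by [left|right].
Qed.

Definition agree (n : nat) (u t : nat -> bool) : Prop :=
  forall m, (m < n)%N -> u m = t m.

Lemma agree_refl n t : agree n t t. Proof. by []. Qed.

Lemma agree_sym n u t : agree n u t -> agree n t u.
Proof. by move=> ut m /ut. Qed.

Lemma agree_trans n u t v : agree n u t -> agree n t v -> agree n u v.
Proof. by move=> ut tv m mn; rewrite ut// tv. Qed.

Lemma agree_le m n u t : (m <= n)%N -> agree n u t -> agree m u t.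
Proof. by move=> mn ut k km; apply: ut; exact: leq_trans mn. Qed.

Definition Delta (u t : nat -> bool) : nat :=
  xget 0%N [set n | agree n u t /\ u n <> t n].

Lemma Delta_eq n u t : agree n u t -> u n <> t n -> Delta u t = n.
Proof.
move=> ut utn; rewrite /Delta; case: xgetP => [m _ [utm utm']|/(_ n)[]//].
have [mn|nm|//] := ltngtP m n; first by case: utm'; exact: ut.
by case: utn; exact: utm.
Qed.

Lemma DeltaP u t : u <> t ->
  agree (Delta u t) u t /\ u (Delta u t) <> t (Delta u t).
Proof.
move=> ut; have [n utn] : exists n, u n != t n.
  apply: contra_notP ut => h; apply/funext => n; apply/eqP.
  by apply: contra_notT h => ?; exists n.
case: (@ex_minnP (fun n => u n != t n)); first by exists n.
move=> m /eqP utm mmin; suff um : agree m u t by rewrite (Delta_eq um).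
move=> k km; apply/eqP; apply: contraTT km => /mmin; by rewrite -leqNgt.
Qed.

Lemma leq_Delta n u t : u <> t -> agree n u t -> (n <= Delta u t)%N.
Proof. by move=> /DeltaP[_ ut] h; rewrite leqNgt; apply/negP => /h. Qed.

Lemma Delta_agree u v t : u <> t -> agree (Delta u t).+1 v u ->
  v <> t /\ Delta v t = Delta u t.
Proof.
move=> /DeltaP[ut1 ut2] vu.
have vt : v (Delta u t) <> t (Delta u t) by rewrite vu.
split; first by move=> e; apply: vt; rewrite e.
apply: Delta_eq => //; apply: agree_trans ut1; exact: agree_le vu.
Qed.

Definition cylinder (s : seq bool) : set (nat -> bool) :=
  [set t | agree (size s) t (nth false s)].

Lemma cylinder_mkseq n t u : cylinder (mkseq t n) u <-> agree n u t.
Proof.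
rewrite /cylinder /= size_mkseq; split=> h m mn; first by rewrite h// nth_mkseq.
by rewrite nth_mkseq// h.
Qed.

Section SplitPoints.
Context (P : (nat -> bool) -> nat -> bool).

Definition side (t : nat -> bool) (x : (nat -> bool) * bool) : bool :=
  if pselect (x.1 = t) then x.2 else P t (Delta x.1 t).

Lemma side_eq t i : side t (t, i) = i.
Proof. by rewrite /side; case: pselect. Qed.

Lemma side_fst x : side x.1 x = x.2.
Proof. by case: x => t i; exact: side_eq. Qed.

Lemma side_neq t x : x.1 <> t -> side t x = P t (Delta x.1 t).
Proof. by rewrite /side; case: pselect. Qed.

Definition split_nbhs (n : nat) (x : (nat -> bool) * bool) :
    set ((nat -> bool) * bool) :=
  [set y | agree n y.1 x.1 /\ side x.1 y = x.2].

Lemma split_nbhs_refl n x : split_nbhs n x x.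
Proof. by case: x => t i; split; [exact: agree_refl|exact: side_eq]. Qed.

Lemma split_nbhs_le m n x : (m <= n)%N -> split_nbhs n x `<=` split_nbhs m x.
Proof. by move=> mn y [h ?]; split=> //; exact: agree_le h. Qed.

(* Away from [t], the neighbourhoods of [(t, i)] are open in the coarse topology
   of the Cantor space. *)
Lemma split_nbhs_cylinder n t i u : u <> t -> agree n u t ->
  P t (Delta u t) = i ->
  [set y | agree (Delta u t).+1 y.1 u] `<=` split_nbhs n (t, i).
Proof.
move=> ut utn Pi y yu; have [yt yE] := Delta_agree ut yu; split => /=.
  apply: agree_trans (utn); apply: agree_le yu.
  exact: leqW (leq_Delta ut utn).
by rewrite side_neq// yE.
Qed.

Definition accumulation_levels (S : nat -> nat -> bool) (t : nat -> bool) :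
  set nat := [set n | exists k, S k <> t /\ Delta (S k) t = n].

Hypothesis P_splits : forall S : nat -> nat -> bool,
  countable [set t | ~ (unbounded (accumulation_levels S t) -> forall b,
    unbounded [set n | accumulation_levels S t n /\ P t n = b])].

Lemma split_accumulation (A : set (nat -> bool)) :
  exists2 S : set (nat -> bool), countable S & S `<=` A /\
    forall t, A t -> ~ S t -> forall b n, exists u,
      [/\ S u, u <> t, agree n u t & P t (Delta u t) = b].
Proof.
have [->|[a0 Aa0]] : A = set0 \/ A !=set0.
- by have [->|/set0P ?] := eqVneq A set0; [left|right].
- by exists set0; [exact: countable0|split].
have /choice[pick pickP] : forall s, exists a,
    A a /\ ((A `&` cylinder s) !=set0 -> cylinder s a).
  move=> s; have [[a [Aa sa]]|n] := pselect ((A `&` cylinder s) !=set0).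
    by exists a.
  by exists a0.
pose S k := pick (odflt [::] (unpickle k)).
exists (range S `|` (A `&` [set t | ~ (unbounded (accumulation_levels S t) ->
    forall b, unbounded [set n | accumulation_levels S t n /\ P t n = b])])).
  apply: countable_setU; first exact/countable_image/countableP.
  by apply: countableS (P_splits S) => t [].
split=> [_ [[k _ <-]|[]//]|t At /not_orP[tS /not_andP[//|/contrapT tP]] b n].
  by have [] := pickP (odflt [::] (unpickle k)).
have uS : unbounded (accumulation_levels S t).
  move=> N; pose v := pick (mkseq t N).
  have vt : agree N v t.
    apply/cylinder_mkseq/(pickP _).2; exists t; split=> //.
    exact/cylinder_mkseq/agree_refl.
  have Sv : S (pickle (mkseq t N)) = v by rewrite /S pickleK.
  have vNt : v <> t by move=> e; apply: tS; exists (pickle (mkseq t N)) => //; rewrite Sv.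
  exists (Delta v t); first exact: leq_Delta.
  by exists (pickle (mkseq t N)); rewrite Sv.
have [m nm [[k [kt km]] Pm]] := tP uS b n.
exists (S k); split=> //; last by rewrite km.
  by left; exists k.
by apply: agree_le (DeltaP kt).1; rewrite km.
Qed.

Lemma uncovered_countable (Q : set ((nat -> bool) * bool) -> Prop)
    (A : set ((nat -> bool) * bool)) :
  (forall B C, B `<=` C -> Q C -> Q B) ->
  (forall x, A x -> exists n, Q (split_nbhs n x)) ->
  countable [set x | A x /\ ~ exists n, Q [set y | agree n y.1 x.1]].
Proof.
move=> Qsub AQ; set Z := [set x | _].
pose G (p : bool * seq bool) := [set t | cylinder p.2 t /\ Z (t, p.1) /\
  Q (split_nbhs (size p.2) (t, p.1))].
have cG p : countable (G p).
  have [S cS [SG Sacc]] := split_accumulation (G p).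
  apply: countableS cS => t Gt; apply: contrapT => nSt.
  have [u [/SG[_ [[_ uQ] _]] ut utp Pu]] := Sacc t Gt nSt p.1 (size p.2).
  apply: uQ; exists (Delta u t).+1; case: Gt => _ [_]; apply: Qsub.
  exact: split_nbhs_cylinder.
apply: (@countableS _ _ (\bigcup_(p in setT) ((fun t => (t, p.1)) @` G p))).
  move=> [t i] Zt; have [n nQ] := AQ _ Zt.1.
  exists (i, mkseq t n) => //; exists t => //; split => /=.
    exact/cylinder_mkseq/agree_refl.
  by split=> //; rewrite size_mkseq.
by apply: bigcup_countable => [|p _]; [exact: countableP|exact: countable_image].
Qed.

End SplitPoints.

Definition cantor_metric (R : realType) : Type := nat -> bool.

HB.instance Definition _ (R : realType) := Choice.on (cantor_metric R).

Section CantorMetric.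
Context (R : realType).
Local Notation cantor_metric := (cantor_metric R).

Let dist (u t : cantor_metric) : R :=
  if pselect (u = t) then 0 else (Delta u t).+1%:R^-1.

Let agree_dist n u t : agree n u t -> dist u t <= n.+1%:R^-1 :> R.
Proof.
rewrite /dist; case: pselect => /= [_ _|ut uta]; first by rewrite invr_ge0.
by rewrite lef_pV2 ?posrE// ler_nat ltnS leq_Delta.
Qed.

Let distxx u : dist u u = 0.
Proof. by rewrite /dist; case: pselect. Qed.

Let dist_eq0 u t : dist u t = 0 -> u = t.
Proof.
by rewrite /dist; case: pselect => // _ /eqP; rewrite invr_eq0 pnatr_eq0.
Qed.

Let dist_sym u t : dist u t = dist t u.
Proof.
rewrite /dist; case: pselect => /= [->|ut]; first by case: pselect.
case: pselect => [tu|tu]; first by case: ut.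
have [ut1 ut2] := DeltaP ut; rewrite (@Delta_eq (Delta u t) t u) //.
  exact: agree_sym.
exact/nesym.
Qed.

Let dist_triangle t u v : dist u v <= dist u t + dist t v.
Proof.
have dist_ge0 x y : 0 <= dist x y by rewrite /dist; case: pselect.
have [<-|ut] := pselect (u = t); first by rewrite distxx add0r.
have [<-|tv] := pselect (t = v); first by rewrite distxx addr0.
have [ut1 ut2] := DeltaP ut; have [tv1 tv2] := DeltaP tv.
have duE : dist u t = (Delta u t).+1%:R^-1 by rewrite /dist; case: pselect.
have dvE : dist t v = (Delta t v).+1%:R^-1 by rewrite /dist; case: pselect.
case: (leqP (Delta u t) (Delta t v)) => h.
  apply: (@le_trans _ _ (dist u t)); last by rewrite lerDl.
  rewrite duE; apply: agree_dist; apply: agree_trans ut1 _.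
  exact: agree_le h tv1.
apply: (@le_trans _ _ (dist t v)); last by rewrite lerDr.
rewrite dvE; apply: agree_dist; apply: agree_trans tv1.
exact: agree_le (ltnW h) ut1.
Qed.

HB.instance Definition _ := @isMetric.Build R cantor_metric dist
  distxx dist_eq0 dist_sym dist_triangle.

Lemma cantor_metric_nbhs (t : cantor_metric) (A : set cantor_metric) :
  nbhs t A -> exists n, [set u | agree n u t] `<=` A.
Proof.
move=> /nbhs_ballP[e /= e0 eA].
have [n ne] : exists n, n.+1%:R^-1 < e.
  exists (Num.truncn e^-1); rewrite invf_plt ?posrE//.
  by apply: real_truncnS_gt; exact: num_real.
exists n => u /agree_sym ut; apply: eA; rewrite ballEmdist /=.
exact: le_lt_trans (agree_dist ut) ne.
Qed.

End CantorMetric.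

Section SplitTopology.
Context (R : realType) (P : (nat -> bool) -> nat -> bool).
Context (X : topologicalType).
Context (pt : (nat -> bool) * bool -> X) (co : X -> (nat -> bool) * bool).
Hypothesis ptK : cancel pt co.
Hypothesis coK : cancel co pt.
Hypothesis nbhsX : forall x A,
  nbhs x A <-> exists n, split_nbhs P n (co x) `<=` pt @^-1` A.
Hypothesis P_splits : forall S : nat -> nat -> bool,
  countable [set t | ~ (unbounded (accumulation_levels S t) -> forall b,
    unbounded [set n | accumulation_levels S t n /\ P t n = b])].
Hypothesis P_unbounded : forall t b, unbounded [set n | P t n = b].

Lemma split_openP (A : set X) : open A <->
  forall x, A (pt x) -> exists n, split_nbhs P n x `<=` pt @^-1` A.
Proof.
rewrite openE; split=> [oA x /oA|h x]; first by move=> /nbhsX; rewrite ptK.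
by rewrite -{1}(coK x) => /h ?; apply/nbhsX.
Qed.

Lemma split_compact : compact [set: X].
Proof.
rewrite compact_ultra => F FU _.
have FF : ProperFilter F by exact: ultra_proper.
pose t n := `[< F [set x | (co x).1 n] >].
have tF n : F [set x | (co x).1 n = t n].
  rewrite /t; case: asboolP => // Fn.
  have [//|] := in_ultra_setVsetC [set x | (co x).1 n] FU.
  by apply: filterS => x /= /negP/negbTE.
have tFn n : F [set x | agree n (co x).1 t].
  elim: n => [|n IH]; first by apply: filterS filterT => x _ [].
  apply: filterS (filterI IH (tF n)) => x [h e] m; rewrite ltnS leq_eqVlt.
  by case/predU1P => [->//|]; exact: h.
pose i := `[< F [set x | side P t (co x)] >].
have iF : F [set x | side P t (co x) = i].
  rewrite /i; case: asboolP => // Fn.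
  have [//|] := in_ultra_setVsetC [set x | side P t (co x)] FU.
  by apply: filterS => x /= /negP/negbTE.
exists (pt (t, i)); split=> // A /nbhsX[n]; rewrite ptK => nA.
apply: filterS (filterI (tFn n) iF) => x [xt xi].
by have := nA (co x) (conj xt xi); rewrite /= coK.
Qed.

Lemma split_isolated : isolated [set: X] = set0.
Proof.
rewrite -subset0 => x [_ [V /nbhsX[n nV]]]; rewrite setIT => Vx.
have [t [i xE]] : exists t i, co x = (t, i) by case: (co x) => t i; exists t, i.
have [m nm Pm] := P_unbounded t i n.
pose u k := if k == m then ~~ t m else t k.
have utm : u m <> t m by rewrite /u eqxx; case: (t m).
have uta : agree m u t by move=> k km; rewrite /u ltn_eqF.
have ut : u <> t by move=> e; apply: utm; rewrite e.
have : V (pt (u, true)).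
  apply: nV; rewrite xE; split => /=; first exact: agree_le uta.
  by rewrite side_neq//= (Delta_eq uta utm).
by rewrite Vx /= => /(congr1 co); rewrite ptK xE => -[/ut].
Qed.

Lemma split_two_to_one : two_to_one_preimage_of_metric R X.
Proof.
exists (cantor_metric R : metricType R), (fun x => (co x).1); split.
- move=> x A /cantor_metric_nbhs[n nA]; apply/nbhsX; exists n => y [yx _].
  by rewrite /= ptK; exact: nA.
- by apply/seteqP; split=> // t _; exists (pt (t, true)); rewrite ?ptK.
- move=> t; pose f k := pt (t, k == 0%N).
  apply: card_le_trans (card_image_le f `I_2); apply: subset_card_le => x /= xt.
  exists (~~ (co x).2 : nat); first by case: (co x).2.
  by rewrite /f -[RHS]coK -xt; case: (co x) => ? [].
Qed.

Lemma split_not_metrizable : ~ metrizable R X.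
Proof.
move=> [M [h [k [ch ck hK kK]]]].
pose d t : R := mdist (h (pt (t, false))) (h (pt (t, true))).
pose A m := [set t | m.+1%:R^-1 <= d t].
have [m mA] : exists m, ~ countable (A m).
  apply: contrapT => /forallNP cA; apply: nat_bool_uncountable.
  apply: (@countableS _ _ (\bigcup_m A m)).
    move=> t _; have d0 : 0 < d t.
      by rewrite mdist_gt0; apply/eqP => /(can_inj hK)/(can_inj ptK) [].
    exists (Num.truncn (d t)^-1) => //; rewrite /A /= invf_ple ?posrE//.
    by apply/ltW/real_truncnS_gt; exact: num_real.
  by apply: bigcup_countable => // i _; apply: contrapT => /cA.
have [S cS [SA Sacc]] := split_accumulation P_splits (A m).
have [t At St] : exists2 t, A m t & ~ S t.
  apply: contrapT => h1; apply: mA; apply: countableS cS => t At.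
  by apply: contrapT => St; apply: h1; exists t.
have e0 : 0 < m.+1%:R^-1 / 2 :> R by rewrite divr_gt0.
have /nbhsX[n] := ch (pt (t, false)) _ (nbhsx_ballx _ _ e0).
rewrite ptK => nh; have [u [/SA um ut utn Pu]] := Sacc t At St false n.
have hu j : ball (h (pt (t, false))) (m.+1%:R^-1 / 2) (h (pt (u, j))).
  by apply: nh; split => //=; rewrite side_neq.
have := ball_triangle (ball_sym (hu false)) (hu true).
by rewrite -splitr ballEmdist /= ltNge => /negP; apply.
Qed.

Lemma split_hereditarily_separable : hereditarily separable_space X.
Proof.
move=> A; have [S cS [SA Sacc]] :=
  split_accumulation P_splits [set t | exists i, A (pt (t, i))].
exists [set y | S (co (set_val y)).1].
  apply/countable_injP; have : countable (pt @` (S `*` setT)).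
    apply: countable_image; apply: countableX => //; exact: countableP.
  move=> /countable_injP[f fI]; exists (f \o set_val) => y z; rewrite !inE.
  have inS (w : set_type A) : S (co (set_val w)).1 ->
      set_val w \in pt @` (S `*` setT).
    by move=> Sw; apply/mem_set; exists (co (set_val w)).
  by move=> /inS Sy /inS Sz /(fI _ _ Sy Sz)/val_inj.
move=> _ /[swap] -[G oO <-] [y Oy].
have [Sy|Sy] := pselect (S (co (set_val y)).1); first by exists y.
have [t [i yE]] : exists t i, co (set_val y) = (t, i).
  by case: (co _) => t i; exists t, i.
have yE' : set_val y = pt (t, i) by rewrite -yE coK.
have At : exists i, A (pt (t, i)) by exists i; rewrite -yE'; exact: set_valP.
have [|n nO] := (split_openP G).1 oO (t, i); first by rewrite -yE'.
rewrite yE in Sy; have [u [Su ut utn Pu]] := Sacc t At Sy i n.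
have [j Auj] := SA _ Su.
exists (SigSub (mem_set Auj)); split; last by rewrite /= ptK.
by apply: nO; split => //=; rewrite side_neq.
Qed.

Lemma split_hereditarily_lindelof : hereditarily lindelof_space X.
Proof.
move=> A U Uopen Ucover.
pose Q B := exists2 G, U G & forall y : set_type A, B (co (set_val y)) -> G y.
have Qsub B C : B `<=` C -> Q C -> Q B.
  by move=> BC [G UO CO]; exists G => // y /BC/CO.
have QA x : A (pt x) -> exists n, Q (split_nbhs P n x).
  move=> Ax; pose y : set_type A := SigSub (mem_set Ax).
  have [G UO Oy] : (\bigcup_(G in U) G) y by rewrite Ucover.
  have [G' oO' G'E] := Uopen _ UO.
  have [|n nO] := (split_openP G').1 oO' x; first by move: Oy; rewrite -G'E.
  exists n, G => // z /nO; rewrite -G'E /= coK; exact.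
have cZ := uncovered_countable P_splits Qsub QA; set Z := [set x | _] in cZ.
have /choice[f fP] (x : (nat -> bool) * bool) : exists G, A (pt x) ->
    U G /\ forall y : set_type A, co (set_val y) = x -> G y.
  have [Ax|] := pselect (A (pt x)); last by exists set0.
  have [n [G UO nO]] := QA x Ax; exists G => _; split=> // y yx.
  by apply: nO; rewrite yx; exact: split_nbhs_refl.
have /choice[g gP] (s : seq bool) : exists G,
    Q [set x | cylinder s x.1] -> U G /\
      forall y : set_type A, cylinder s (co (set_val y)).1 -> G y.
  by have [[G UO sO]|] := pselect (Q [set x | cylinder s x.1]);
    [exists G | exists set0].
exists (f @` Z `|` g @` [set s | Q [set x | cylinder s x.1]]); split.
- by move=> G [[x [Ax _] <-]|[s Qs <-]]; [exact: (fP _ Ax).1|exact: (gP _ Qs).1].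
- by apply: countable_setU; apply: countable_image => //; exact: countableP.
- apply/seteqP; split=> // y _; pose x := co (set_val y).
  have Ax : A (pt x) by rewrite /x coK; exact: set_valP.
  have [Zx|/not_andP[//|/contrapT[n nQ]]] := pselect (Z x).
    by exists (f x); [left; exists x|exact: (fP x Ax).2].
  have Qs : Q [set y | cylinder (mkseq x.1 n) y.1].
    by apply: Qsub nQ => z /cylinder_mkseq.
  exists (g (mkseq x.1 n)); first by right; exists (mkseq x.1 n).
  by apply: (gP _ Qs).2; exact/cylinder_mkseq/agree_refl.
Qed.

End SplitTopology.

Section SeparableMeasure.
Context d (T : measurableType d) (R : realType).
Context (mu : {finite_measure set T -> \bar R}) (J : countType) (C : J -> set T).
Hypothesis mC : forall i, measurable (C i).

Local Notation L := (Lfun mu 1).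
Local Notation N f := ('N[mu]_1[EFin \o f%R])%E.

Let L_comb (a : R) (f g : T -> R) : f \in L -> g \in L -> a *: f + g \in L.
Proof. exact: (Lfun_submod_closed mu (lexx 1%E)).2. Qed.

Let L0 : (0 : T -> R) \in L.
Proof. exact: (Lfun_submod_closed mu (lexx 1%E)).1. Qed.

Let LD (f g : T -> R) : f \in L -> g \in L -> f + g \in L.
Proof. by move=> fL gL; rewrite -[f]scale1r; exact: L_comb. Qed.

Let LZ (a : R) (f : T -> R) : f \in L -> a *: f \in L.
Proof. by move=> fL; rewrite -[_ *: _]addr0; exact: L_comb. Qed.

Let LB (f g : T -> R) : f \in L -> g \in L -> f - g \in L.
Proof. by move=> fL gL; rewrite addrC -scaleN1r; exact: L_comb. Qed.

Let L_measurable (f : T -> R) : f \in L -> measurable_fun setT f.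
Proof. by move=> /sub_Lfun_mfun; rewrite inE. Qed.

Let L_indic (A : set T) : measurable A -> (\1_A : T -> R) \in L.
Proof. by move=> mA; apply/Lfun1_integrable; exact: integrable_indic. Qed.

Let N_fin (f : T -> R) : f \in L -> N f \is a fin_num.
Proof.
move=> /sub_Lfun_finLfun; rewrite inE /= => fL.
by rewrite ge0_fin_numE// Lnorm_ge0.
Qed.

Let ND (f g : T -> R) : f \in L -> g \in L -> (N (f + g) <= N f + N g)%E.
Proof. by move=> fL gL; apply: minkowski_EFin => //; exact: L_measurable. Qed.

Let NZ (a : R) (f : T -> R) : f \in L -> N (a *: f) = (`|a|%:E * N f)%E.
Proof. by move=> fL; exact: (LnormZ (Lfun_Sub (lexx 1%E) fL) a). Qed.

Let N_triangle (g f h : T -> R) (a b : R) : f \in L -> g \in L -> h \in L ->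
  (N (f - g) < a%:E -> N (g - h) < b%:E -> N (f - h) < (a + b)%:E)%E.
Proof.
move=> fL gL hL fg gh; rewrite EFinD -(subrKA g).
by apply: le_lt_trans (ND _ _) (lteD fg gh); exact: LB.
Qed.

Definition rat_comb (l : seq (rat * J)) : T -> R :=
  \sum_(p <- l) ratr p.1 *: (\1_(C p.2) : T -> R).

Lemma rat_comb_Lfun l : rat_comb l \in L.
Proof.
by rewrite /rat_comb; elim/big_ind: _ => // p _; apply: LZ; exact: L_indic.
Qed.

Definition rat_approx (f : T -> R) : Prop := f \in L /\
  forall e : R, 0 < e -> exists l, (N (f - rat_comb l) < e%:E)%E.

Lemma rat_approx_limit f : f \in L ->
  (forall e : R, 0 < e -> exists2 g, rat_approx g & (N (f - g) < e%:E)%E) ->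
  rat_approx f.
Proof.
move=> fL fg; split=> // e e0; have e20 : 0 < e / 2 by rewrite divr_gt0.
have [g [gL /(_ _ e20)[l gl]] fge] := fg _ e20.
exists l; rewrite (splitr e); apply: (@N_triangle g) => //.
exact: rat_comb_Lfun.
Qed.

Lemma rat_approx0 : rat_approx 0.
Proof.
split=> // e e0; exists [::]; rewrite /rat_comb big_nil subr0.
by rewrite [X in (X < _)%E](@Lnorm0 _ _ _ mu 1%E) ?lte_fin.
Qed.

Lemma rat_approxD f g : rat_approx f -> rat_approx g -> rat_approx (f + g).
Proof.
move=> [fL fe] [gL ge]; split=> [|e e0]; first exact: LD.
have e20 : 0 < e / 2 by rewrite divr_gt0.
have [[l fl] [m gm]] := (fe _ e20, ge _ e20).
exists (l ++ m); rewrite /rat_comb big_cat -!/(rat_comb _) /= (splitr e).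
rewrite opprD addrACA; apply: le_lt_trans (ND _ _) _.
- by apply: LB => //; exact: rat_comb_Lfun.
- by apply: LB => //; exact: rat_comb_Lfun.
- by rewrite EFinD; exact: lteD.
Qed.

Lemma rat_approxZ a f : rat_approx f -> rat_approx (a *: f).
Proof.
move=> [fL fe]; apply: rat_approx_limit => [|e e0]; first exact: LZ.
pose c := fine (N f) + 1.
have c0 : 0 < c by rewrite ltr_wpDl// fine_ge0// Lnorm_ge0.
have [q aq] : exists q : rat, `|a - ratr q| < e / c.
  have ec : 0 < e / c by rewrite divr_gt0.
  have [|q] := @rat_in_itvoo R (a - e / c) (a + e / c).
    by rewrite ltrD2l gt0_cp.
  rewrite in_itv /= => /andP[q1 q2]; exists q.
  by rewrite distrC ltr_distl q1 q2.
exists (ratr q *: f).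
  split=> [|r r0]; first exact: LZ.
  pose b : R := `|ratr q| + 1.
  have b0 : 0 < b by rewrite ltr_wpDl.
  have [|l fl] := fe (r / b); first by rewrite divr_gt0.
  exists [seq (q * p.1, p.2) | p <- l].
  have -> : rat_comb [seq (q * p.1, p.2) | p <- l] = ratr q *: rat_comb l.
    rewrite /rat_comb big_map scaler_sumr; apply: eq_bigr => p _ /=.
    by rewrite rmorphM scalerA.
  rewrite -scalerBr NZ; last by apply: LB => //; exact: rat_comb_Lfun.
  apply: (@le_lt_trans _ _ (b%:E * N (f - rat_comb l))%E).
    by apply: lee_wpmul2r; rewrite ?Lnorm_ge0// lee_fin /b lerDl.
  by rewrite muleC -lte_pdivlMr.
rewrite -scalerBl NZ// -(fineK (N_fin fL)) -EFinM lte_fin.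
apply: (@le_lt_trans _ _ (`|a - ratr q| * c)).
  by rewrite ler_wpM2l// /c lerDl.
by rewrite -ltr_pdivlMr.
Qed.

Lemma rat_approx_sum (A : Type) (s : seq A) (f : A -> T -> R) :
  (forall j, rat_approx (f j)) -> rat_approx (\sum_(j <- s) f j).
Proof.
by move=> fa; elim/big_ind: _ => //; [exact: rat_approx0|exact: rat_approxD].
Qed.

Lemma rat_approx_generator i : rat_approx \1_(C i).
Proof.
split=> [|e e0]; first exact: L_indic.
exists [:: (1, i)]; rewrite /rat_comb big_seq1 /= rmorph1 scale1r subrr.
by rewrite [X in (X < _)%E](@Lnorm0 _ _ _ mu 1%E) ?lte_fin.
Qed.

Let N_indic (A : set T) : measurable A -> N (\1_A : T -> R) = mu A.
Proof.
move=> mA; rewrite Lnorm1 -[in RHS](setIT A) -integral_indic//.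
by apply: eq_integral => x _; rewrite /= ger0_norm.
Qed.

Lemma rat_approx_indic (G : set (set T)) :
  @measurable _ T = <<s G >> -> setI_closed G -> G setT ->
  (forall A, G A -> rat_approx \1_A) ->
  forall A, measurable A -> rat_approx \1_A.
Proof.
move=> mG GI GT Ga A; rewrite mG.
apply: (dynkin_induction mG GI (P := fun A => rat_approx \1_A)) => //.
- exact: Ga.
- move=> S mS Sa; suff -> : (\1_(~` S) : T -> R) = \1_setT + (-1) *: \1_S.
    by apply: rat_approxD; [exact: Ga|exact: rat_approxZ].
  apply/funext => x; rewrite indicC scaleN1r /=.
  by rewrite !fctE !indicE in_setT; case: (x \in S); rewrite ?subrr ?subr0.
- move=> F mF tF Fa; have mU : measurable (\bigcup_k F k).
    exact: bigcup_measurable.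
  apply: rat_approx_limit => [|e e0]; first exact: L_indic.
  pose B n := \big[setU/set0]_(i < n) F i.
  have mB n : measurable (B n) by exact: bigsetU_measurable.
  have B_approx n : rat_approx \1_(B n).
    elim: n => [|n IH]; first by rewrite /B big_ord0 indic0; exact: rat_approx0.
    suff -> : (\1_(B n.+1) : T -> R) = \1_(B n) + \1_(F n) by exact: rat_approxD.
    apply/funext => x; rewrite /B big_ord_recr /= -/(B n) !fctE !indicE in_setU.
    have [xB|] := boolP (x \in B n); last by rewrite add0r.
    have [xF|] := boolP (x \in F n); last by rewrite addr0.
    move: xB xF; rewrite !inE /B -bigcup_mkord => -[k /= kn Fkx] Fnx.
    have kE : k = n by apply: tF => //; exists x.
    by rewrite kE ltnn in kn.
  pose D n := (\bigcup_k F k) `\` B n.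
  have mD n : measurable (D n) by exact: measurableD.
  have D0 : mu \o D @ \oo --> 0%E.
    have -> : 0%E = mu (\bigcap_n D n).
      rewrite -[LHS](measure0 mu); congr (mu _); apply/esym; rewrite -subset0 => x.
      move=> DDx; have [[k _ Fkx] _] := DDx 0%N I.
      have [_] := DDx k.+1 I; apply; rewrite /B -bigcup_mkord.
      by exists k => //=.
    apply: (@nonincreasing_cvg_mu _ _ _ mu D) => //.
    - by rewrite ltey_eq fin_num_measure.
    - exact: bigcapT_measurable.
    - move=> m n mn; apply/subsetPset; apply: setDS; exact: subset_bigsetU.
  have /(_ [set r | (r < e%:E)%E])[] := D0.
    by apply: open_nbhs_nbhs; split; [exact: open_ereal_lt_ereal|rewrite /= lte_fin].
  move=> n _ /(_ n (leqnn n)) /= De; exists (\1_(B n)) => //.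
  suff -> : (\1_(\bigcup_k F k) - \1_(B n) : T -> R) = \1_(D n).
    by rewrite N_indic.
  apply/funext => x; rewrite !fctE !indicE /D in_setD.
  have [xB|] := boolP (x \in B n); last by rewrite subr0 andbT.
  have -> : x \in \bigcup_k F k.
    by move: xB; rewrite !inE; exact: bigsetU_bigcup.
  by rewrite subrr.
Qed.

Import HBSimple.

Lemma rat_approx_Lfun (f : T -> R) :
  (forall A, measurable A -> rat_approx \1_A) -> f \in L -> rat_approx f.
Proof.
move=> Aa fL; apply: rat_approx_limit => // e e0.
have fI : mu.-integrable setT (EFin \o f) by exact/Lfun1_integrable.
have [g [_ _ /(_ [set r | (r < e%:E)%E])[]]] := approximation_sfun_integrable measurableT fI.
  by apply: open_nbhs_nbhs; split; [exact: open_ereal_lt_ereal|rewrite /= lte_fin].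
move=> n _ /(_ n (leqnn n)) /= ge; exists (g n); last by rewrite Lnorm1.
suff -> : (g n : T -> R) = \sum_(r <- finmap.enum_fset (fset_set (range (g n))))
    r *: \1_(g n @^-1` [set r]).
  by apply: rat_approx_sum => r; apply: rat_approxZ; exact: Aa.
apply/funext => x; rewrite fimfunE fsbig_finite//= fct_sumE.
by apply: eq_bigr.
Qed.

Let Lspace_representative (f : T -> R) : f \in L ->
  exists2 g : LspaceType1 mu, (g : T -> R) \in L & (N (f - (g : T -> R)) = 0)%E.
Proof.
move=> fL; have mf : measurable_fun setT f by exact: L_measurable.
pose f0 : {mfun T >-> measurableTypeR R} :=
  HB.pack f (isMeasurableFun.Build _ _ T (measurableTypeR R) f mf).
pose g0 : {mfun_ mu, T >-> measurableTypeR R} := \pi_(_)%qT f0.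
have fg : f0 = repr g0 %[ae mu].
  by apply/asboolP/(eqquotP {mfun_ mu, T >-> measurableTypeR R}); rewrite reprK.
have mg : measurable_fun setT (g0 : T -> R).
  exact: (@measurable_funPT _ _ _ _ (repr g0)).
have N0 h k : measurable_fun setT h -> measurable_fun setT k ->
    h = k %[ae mu] -> (N ((h : T -> R) - (k : T -> R)) = 0)%E.
  move=> mh mk hk; rewrite Lnorm1; apply/(ae_eq_integral_abs mu measurableT).
    by apply/measurable_EFinP; exact: measurable_funB.
  by apply: filterS hk => x /(_ I) /= hkx _; rewrite !fctE hkx /= subrr.
have gfin : finite_norm mu 1 (g0 : T -> R).
  rewrite /finite_norm (_ : (g0 : T -> R) = f + ((g0 : T -> R) - f)).
    apply: (@le_lt_trans _ _ (N f + N ((g0 : T -> R) - f))%E).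
      by apply: minkowski_EFin => //; exact: measurable_funB.
    by rewrite N0 ?adde0 ?ltey_eq ?N_fin//; exact: ae_eq_sym.
  by rewrite subrKC.
have gL : (g0 : T -> R) \in L.
  by apply/andP; split; rewrite inE.
by exists (LebesgueSpace.pack_ (isFinLebesgue.Build _ _ _ mu _ (lexx 1%E) g0 gfin)) => //=;
  exact: N0.
Qed.

Lemma separable_measureP :
  (forall A, measurable A -> rat_approx \1_A) -> separable_measure mu.
Proof.
move=> Aa.
have /choice[g gP] (l : seq (rat * J)) : exists g : LspaceType1 mu,
    (g : T -> R) \in L /\ (N (rat_comb l - (g : T -> R)) = 0)%E.
  by have [g gL g0] := Lspace_representative (rat_comb_Lfun l); exists g.
exists (range g); first exact/countable_image/countableP.
move=> f e e0; have fL : (f : T -> R) \in L.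
  apply/andP; split; rewrite inE /=; last exact: Lebesgue_finite.
  exact: (@measurable_funPT _ _ _ _ (repr (LebesgueSpace.sort f))).
have [l fl] := (rat_approx_Lfun Aa fL).2 e e0.
exists (g l); first by exists l.
rewrite (_ : (f : T -> R) \- (g l : T -> R) =
  ((f : T -> R) - rat_comb l) + (rat_comb l - (g l : T -> R))); last by rewrite subrKA.
apply: le_lt_trans (ND _ _) _.
- by apply: LB => //; exact: rat_comb_Lfun.
- by apply: LB; [exact: rat_comb_Lfun|exact: (gP l).1].
- by rewrite (gP l).2 adde0.
Qed.

End SeparableMeasure.

Lemma countable_atoms d (T : measurableType d) (R : realType)
    (mu : {finite_measure set T -> \bar R}) :
  (forall x : T, measurable [set x]) -> countable [set x | mu [set x] != 0%E].
Proof.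
move=> m1; pose A m := [set x | (m.+1%:R^-1%:E <= mu [set x])%E].
apply: (@countableS _ _ (\bigcup_m A m)) => [x /= x0|].
  have mux : 0 < fine (mu [set x]).
    by rewrite fine_gt0// lt0e x0 measure_ge0 /= ltey_eq fin_num_measure.
  exists (Num.truncn (fine (mu [set x]))^-1) => //.
  rewrite /A /= -(fineK (fin_num_measure mu _ (m1 x))) lee_fin.
  rewrite invf_ple ?posrE//.
  by apply/ltW/real_truncnS_gt; exact: num_real.
apply: bigcup_countable => // m _; apply: finite_set_countable.
apply: contrapT => /infiniteP/pcard_leP[f].
pose B n := \big[setU/set0]_(i < n) [set f i].
have mB n : measurable (B n) by exact: bigsetU_measurable.
have muB n : ((n%:R * m.+1%:R^-1)%:E <= mu (B n))%E.
  elim: n => [|n IH]; first by rewrite mul0r measure_ge0.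
  have -> : B n.+1 = B n `|` [set f n] by rewrite /B big_ord_recr.
  rewrite measureU//; last first.
    rewrite /B -subset0 -(bigcup_mkord n (fun k => [set f k])) => x [[k /= kn ->]] /inj.
    by rewrite !inE => /(_ I I) kE; rewrite kE ltnn in kn.
  rewrite -natr1 mulrDl mul1r EFinD; apply: leeD => //.
  exact: (@funS _ _ _ _ f n I).
have := real_truncnS_gt (num_real (fine (mu setT) * m.+1%:R)).
set n := Num.truncn _; rewrite -ltr_pdivlMr// ltNge => /negP; apply.
rewrite -lee_fin fineK ?fin_num_measure//; apply: le_trans (muB _) _.
by apply: le_measure => //; rewrite inE.
Qed.

Lemma cylinderI (s s' : seq bool) : (size s <= size s')%N ->
  cylinder s `&` cylinder s' = set0 \/ cylinder s `&` cylinder s' = cylinder s'.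
Proof.
move=> ss'; have [->|/set0P[t [ts ts']]] := eqVneq (cylinder s `&` cylinder s') set0.
  by left.
right; apply/seteqP; split=> [u []//|u us']; split=> //.
apply: agree_trans ts; apply: agree_le ss' _.
by apply: agree_trans us' _; exact: agree_sym.
Qed.

Section SplitMeasure.
Context (R : realType) (P : (nat -> bool) -> nat -> bool).
Context (X : topologicalType).
Context (pt : (nat -> bool) * bool -> X) (co : X -> (nat -> bool) * bool).
Hypothesis ptK : cancel pt co.
Hypothesis coK : cancel co pt.
Hypothesis nbhsX : forall x A,
  nbhs x A <-> exists n, split_nbhs P n (co x) `<=` pt @^-1` A.
Hypothesis P_splits : forall S : nat -> nat -> bool,
  countable [set t | ~ (unbounded (accumulation_levels S t) -> forall b,
    unbounded [set n | accumulation_levels S t n /\ P t n = b])].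

Let cyl (s : seq bool) : set X := [set x | cylinder s (co x).1].

Let open_cyl s : open (cyl s).
Proof.
apply/(split_openP ptK coK nbhsX) => x; rewrite /cyl /= ptK => sx.
exists (size s) => y [yx _]; rewrite /= ptK; exact: agree_trans yx sx.
Qed.

Let closed1 (x : X) : closed [set x].
Proof.
rewrite -openC; apply/(split_openP ptK coK nbhsX) => y yx.
have [yx1|yx1] := pselect (y.1 = (co x).1).
  exists 0%N => z [_ zy] zx; apply: yx; apply: (can_inj coK).
  rewrite ptK [LHS]surjective_pairing [RHS]surjective_pairing yx1 -zy.
  by rewrite yx1 -zx ptK side_fst.
exists (Delta y.1 (co x).1).+1 => z [zy _] zx.
by have [+ _] := Delta_agree yx1 zy; rewrite -zx ptK.
Qed.

Lemma split_open_decomposition (A : set X) : open A ->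
  exists2 Z : set X, countable Z &
    exists D : set (seq bool), A = Z `|` \bigcup_(s in D) cyl s.
Proof.
move=> /(split_openP ptK coK nbhsX) oA.
have Qsub (B C : set ((nat -> bool) * bool)) :
    B `<=` C -> C `<=` pt @^-1` A -> B `<=` pt @^-1` A by exact: subset_trans.
have := uncovered_countable P_splits Qsub oA; set Z := [set x | _] => cZ.
exists (pt @` Z); first exact: countable_image.
exists [set s | cyl s `<=` A]; apply/seteqP; split=> [x Ax|x].
  have [Zx|] := pselect (Z (co x)); first by left; exists (co x).
  rewrite /Z /= coK => /not_andP[//|/contrapT[n nA]]; right.
  exists (mkseq (co x).1 n); last exact/cylinder_mkseq/agree_refl.
  by move=> y /cylinder_mkseq/nA; rewrite /= coK.
by case=> [[y [Ay _] <-]//|[s sA /sA]].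
Qed.

Lemma split_radon_separable : all_radon_separable R X.
Proof.
move=> p mu _; pose T : measurableType _ := borel_at p.
have mE : @measurable _ T = <<s (@open X : set (set T)) >> by [].
have mO (A : set T) : open (A : set X) -> measurable A.
  by move=> oA; rewrite mE; exact: sub_sigma_algebra.
have m1 (x : T) : measurable [set x].
  have oC : open (~` [set (x : X)]) := closed_openC (@closed1 x).
  rewrite -[[set x]]setCK; apply: measurableC; exact: (mO _ oC).
pose G : set (set T) := range cyl `|` (range (@set1 T) `|` [set set0]).
have G_measurable A : G A -> measurable A.
  by move=> [[s _ <-]|[[x _ <-]|->]]; [exact: (mO _ (open_cyl s))|exact: m1|exact: measurable0].
have mG : @measurable _ T = <<s G >>.
  rewrite mE; apply/seteqP; split; apply: smallest_sub.
  - exact: smallest_sigma_algebra.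
  - move=> A /split_open_decomposition[Z /countable_enum[e eZ] [D AE]].
    pose F (j : seq bool + nat) : set T :=
      match j with
      | inl s => if pselect (D s) then cyl s else set0
      | inr k => if e k is Some x then [set x] `&` Z else set0
      end.
    have GF j : <<s G >> (F j).
      apply: sub_sigma_algebra; case: j => [s|k] /=.
        by case: (pselect (D s)) => h; [left; exists s|right; right].
      case: (e k) => [x|]; last by right; right.
      right; have [Zx|Zx] := pselect (Z x); [left; exists x => //|right].
        by apply/seteqP; split=> [y ->|y []].
      by apply/seteqP; split=> // y [->].
    suff -> : A = \bigcup_k oapp F set0 (unpickle k).
      apply: sigma_algebra_bigcup => k; case: (unpickle k) => [j|] /=.
        exact: GF.
      by apply: sub_sigma_algebra; right; right.
    rewrite AE; apply/seteqP; split=> [x|x [k _]].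
      case=> [Zx|[s Ds sx]].
        have [k ek] := eZ _ Zx.
        by exists (pickle (inr k : seq bool + nat)); rewrite // pickleK /= ek.
      exists (pickle (inl s : seq bool + nat)); rewrite // pickleK /=.
      by case: pselect.
    case: (unpickle k) => [[s|i]|//] /=.
      by case: pselect => //= Ds sx; right; exists s.
    by case: (e i) => // y [_]; left.
  - exact: smallest_sigma_algebra.
  - exact: G_measurable.
have [e eP] := countable_enum (countable_atoms mu m1).
pose C (j : seq bool + nat) : set T :=
  match j with
  | inl s => cyl s
  | inr k => if e k is Some x then [set x] else set0
  end.
have mC j : measurable (C j).
  case: j => [s|k] /=; first exact: (mO _ (open_cyl s)).
  by case: (e k) => [x|]; [exact: m1|exact: measurable0].
apply: (separable_measureP mC); apply: (rat_approx_indic mC mG).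
- have G0 : G set0 by right; right.
  have G1 x A : G ([set x] `&` A).
    have [Ax|Ax] := pselect (A x).
      right; left; exists x => //.
      by apply/seteqP; split=> [y ->|y []].
    suff -> : [set x] `&` A = set0 by [].
    by rewrite -subset0 => y [->].
  move=> _ B [[s _ <-]|[[x _ <-]|->]]; [|by move=> _; exact: G1|by move=> _; rewrite set0I].
  case=> [[s' _ <-]|[[x _ <-]|->]]; [|by rewrite setIC; exact: G1|by rewrite setI0].
  have cylI r r' : (size r <= size r')%N -> G (cyl r `&` cyl r').
    have cylE : cyl r `&` cyl r' =
      (fun x => (co x).1) @^-1` (cylinder r `&` cylinder r') by [].
    move=> /cylinderI[E0|E0]; rewrite cylE E0; first by rewrite preimage_set0.
    by left; exists r'.
  have [ss'|/ltnW ss'] := leqP (size s) (size s'); first exact: cylI.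
  by rewrite setIC; exact: cylI.
- by left; exists [::] => //; apply/seteqP; split.
- move=> _ [[s _ <-]|[[x _ <-]|->]]; last first.
  + by rewrite indic0; exact: rat_approx0.
  + have [x0|/eP[k ek]] := eqVneq (mu [set x]) 0%E; last first.
      by have := rat_approx_generator mu mC (inr k); rewrite /= ek.
    apply: (@rat_approx_limit _ _ _ mu _ C mC).
      by apply/Lfun1_integrable; exact: integrable_indic.
    move=> r r0; exists 0; first exact: rat_approx0.
    rewrite subr0 Lnorm1; under eq_integral do rewrite /= ger0_norm//.
    rewrite integral_indic// setIT.
    have mux : mu [set x] = 0%E by [].
    by apply: (@le_lt_trans _ _ (mu [set x])) => //; rewrite mux lte_fin.
  + exact: (rat_approx_generator mu mC (inl s)).
Qed.

End SplitMeasure.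

Section RealCodes.
Context (R : realType) (I : countType).

(* A family of reals indexed by [I] is coded by its rational lower cuts. *)
Definition decode_reals (o : nat -> bool) (i : I) : R :=
  sup [set ratr q | q in [set q : rat | o (pickle (i, q))]].

Lemma decode_reals_surj (v : I -> R) : exists o, decode_reals o = v.
Proof.
exists (fun n => if unpickle n is Some (i, q) then (ratr q : R) < v i else false).
apply/funext => i; rewrite /decode_reals.
rewrite (_ : [set q : rat | _] = [set q : rat | (ratr q : R) < v i]); last first.
  by apply/seteqP; split=> q /=; rewrite pickleK.
have [q0] : exists q, (ratr q : R) \in `](v i - 1), (v i)[.
  by apply: rat_in_itvoo; rewrite ltrBlDr ltrDl.
rewrite in_itv /= => /andP[_ q0v].
apply/eqP; rewrite eq_le; apply/andP; split.
  by apply: ge_sup => [|_ [q /= /ltW ? <-]//]; exists (ratr q0), q0.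
rewrite leNgt; apply/negP => /rat_in_itvoo[q]; rewrite in_itv /= => /andP[q1 q2].
move: q1; rewrite ltNge => /negP; apply; apply: ub_le_sup; last by exists q.
by exists (v i) => _ [r /= /ltW ? <-].
Qed.

End RealCodes.

Definition dyadic (s : seq bool) : nat -> bool := nth false s.

Lemma dyadic_Delta t n : exists s, [/\ dyadic s <> t, agree n (dyadic s) t &
  Delta (dyadic s) t = n].
Proof.
pose s := rcons (mkseq t n) (~~ t n).
have sa : agree n (dyadic s) t.
  by move=> m mn; rewrite /dyadic nth_rcons size_mkseq mn nth_mkseq.
have sn : dyadic s n <> t n.
  by rewrite /dyadic nth_rcons size_mkseq ltnn eqxx; case: (t n).
exists s; split=> //; first by move=> e; apply: sn; rewrite e.
exact: Delta_eq.
Qed.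

Section RosenthalCodes.
Context (R : realType).

Definition code_index : countType := (nat * nat + seq bool * nat * nat)%type.

(* [v] lists the distances of a dense sequence in a Polish space and, for every
   dyadic point [s], the values on that sequence of continuous functions whose
   pointwise limit is a Baire 1 function; [coded_family v] is the set of all
   evaluations [s |-> f_s(p)] of these Baire 1 functions at points [p] of the
   Polish space. *)
Definition coded_family (v : code_index -> R) : set (seq bool -> R) :=
  [set f | exists i : nat -> nat, exists h : seq bool -> nat -> R,
    [/\ forall e, 0 < e -> exists N, forall j k, (N <= j)%N -> (N <= k)%N ->
          v (inl (i j, i k)) < e,
        forall s k, v (inr (s, k, i j)) @[j --> \oo] --> h s k &
        forall s, h s k @[k --> \oo] --> f s]].

Definition separating_pattern (F : set (seq bool -> R)) (t Q : nat -> bool) :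
    Prop :=
  exists f a b, [/\ F f, a <> b & forall e, 0 < e -> exists N, forall s,
    agree N (dyadic s) t -> dyadic s <> t ->
    `|f s - (if Q (Delta (dyadic s) t) then a else b)| < e].

Definition predicted_pattern (F : set (seq bool -> R)) (t Q : nat -> bool) :
    Prop :=
  [/\ forall b, unbounded [set n | Q n = b], separating_pattern F t Q &
    forall Q', separating_pattern F t Q' -> forall b,
      ~ forall c, unbounded [set n | Q n = b /\ Q' n = c]].

Lemma predicted_pattern_unique F t Q Q' :
  predicted_pattern F t Q -> predicted_pattern F t Q' ->
  exists c, ~ unbounded [set n | Q' n = Q n (+) c].
Proof.
move=> [_ _ Qmin] [uQ' sQ' _].
have /existsNP[c1 /unboundedPn[N1 h1]] := Qmin _ sQ' true.
have /existsNP[c0 /unboundedPn[N0 h0]] := Qmin _ sQ' false.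
have [c10|c10] := eqVneq c1 c0.
  have [n] := uQ' c1 (maxn N0 N1); rewrite geq_max => /andP[n0 n1] /= Qn.
  case Qb : (Q n); first by case: (h1 n n1).
  by case: (h0 n n0); split=> //; rewrite -c10.
exists (~~ c1) => /(_ (maxn N0 N1))[n]; rewrite geq_max => /andP[n0 n1] /= Qn.
case Qb : (Q n); first by case: (h1 n n1); split=> //; rewrite Qn Qb; case: (c1).
case: (h0 n n0); split=> //; rewrite Qn Qb.
by move: c10; case: (c1); case: (c0).
Qed.

End RosenthalCodes.

Section SplitRosenthal.
Context (R : realType) (P : (nat -> bool) -> nat -> bool).
Context (X : topologicalType).
Context (pt : (nat -> bool) * bool -> X) (co : X -> (nat -> bool) * bool).
Hypothesis ptK : cancel pt co.
Hypothesis nbhsX : forall x A,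
  nbhs x A <-> exists n, split_nbhs P n (co x) `<=` pt @^-1` A.
Hypothesis P_unbounded : forall t b, unbounded [set n | P t n = b].

Lemma evaluation_pattern (f : X -> R) t e : continuous f -> 0 < e ->
  exists N, forall u j, agree N u t -> u <> t ->
    `|f (pt (u, j)) -
      (if P t (Delta u t) then f (pt (t, true)) else f (pt (t, false)))| < e.
Proof.
move=> cf e0.
have fN i : exists N, forall u j, agree N u t -> u <> t -> P t (Delta u t) = i ->
    `|f (pt (u, j)) - f (pt (t, i))| < e.
  have /cvgrPdist_lt/(_ _ e0)/nbhsX[N] := cf (pt (t, i)).
  rewrite ptK => fN; exists N => u j ut utn Pu.
  by rewrite distrC; apply: fN; split=> //; rewrite side_neq.
have [[N1 h1] [N0 h0]] := (fN true, fN false).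
exists (maxn N0 N1) => u j uta ut; case: ifP => Pu.
  by apply: h1 => //; apply: agree_le uta; exact: leq_maxr.
by apply: h0 => //; apply: agree_le uta; exact: leq_maxl.
Qed.

Lemma coded_family_predicted (F : set (seq bool -> R)) (Y : Type)
    (ev : Y -> X -> R) t :
  (forall y, continuous (ev y)) ->
  (exists y, ev y (pt (t, true)) <> ev y (pt (t, false))) ->
  F = range (fun y s => ev y (pt (dyadic s, false))) ->
  predicted_pattern F t (P t).
Proof.
move=> cev [y y10] ->; split=> //.
  exists (fun s => ev y (pt (dyadic s, false))).
  exists (ev y (pt (t, true))), (ev y (pt (t, false))); split=> //.
  move=> e e0; have [N hN] := evaluation_pattern t (cev y) e0.
  by exists N => s; exact: hN.
move=> Q [_ [a [b [[z _ <-] ab hQ]]]] i uPQ.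
have lim c : ev z (pt (t, i)) = if c then a else b.
  apply/eqP; rewrite -subr_eq0 -normr_le0; apply/ler_addgt0Pr => e e0.
  rewrite add0r; have e20 : 0 < e / 2 by rewrite divr_gt0.
  have [[N1 h1] [N2 h2]] := (hQ _ e20, evaluation_pattern t (cev z) e20).
  have [n + [Pn Qn]] := uPQ c (maxn N1 N2).
  rewrite geq_max => /andP[n1 n2]; have [s [st sa sn]] := dyadic_Delta t n.
  have := h1 s (agree_le n1 sa) st; have := h2 _ false (agree_le n2 sa) st.
  rewrite sn Qn Pn (_ : (if i then _ else _) = ev z (pt (t, i))); last by case: (i).
  rewrite distrC => d1 d2; rewrite (splitr e); apply/ltW.
  by apply: le_lt_trans (ler_distD _ _ _) (ltrD d1 d2).
by apply: ab; rewrite -(lim true) -(lim false).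
Qed.

End SplitRosenthal.

Lemma polish_coded_family (R : realType) (Y : topologicalType)
    (phi : seq bool -> Y -> R) (y0 : Y) : polish R Y ->
  (forall s, @baire1 R Y (phi s)) ->
  exists v, @coded_family R v = range (fun y s => phi s y).
Proof.
move=> [[D cD dD] [M Mcomplete [hm [km [chm ckm hmK kmK]]]]] phi1.
have /choice[g gphi] (s : seq bool) : exists g : nat -> Y -> R,
    (forall n, continuous (g n)) /\ forall x, g n x @[n --> \oo] --> phi s x.
  by have [g g1 g2] := phi1 s; exists g.
have [d0 Dd0] : D !=set0.
  have [||d [_ Dd]] := dD setT; [by exists y0|exact: openT|by exists d].
have [e eD] := countable_enum cD.
pose q n := odflt d0 (e n).
have qD d : D d -> exists n, q n = d by move=> /eD[n en]; exists n; rewrite /q en.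
pose v (c : code_index) : R :=
  match c with
  | inl (i, j) => mdist (hm (q i)) (hm (q j))
  | inr (s, k, i) => g s k (q i)
  end.
have inv_small (r : R) : 0 < r -> exists n, forall j, (n <= j)%N -> j.+1%:R^-1 < r.
  move=> r0; exists (Num.truncn r^-1) => j nj; rewrite invf_plt ?posrE//.
  apply: lt_le_trans (_ : (Num.truncn r^-1).+1%:R <= _); last by rewrite ler_nat.
  by apply: real_truncnS_gt; exact: num_real.
exists v; apply/seteqP; split=> f.
  move=> [i [h [icauchy gh hf]]].
  have [x xlim] : exists x : M, hm (q (i j)) @[j --> \oo] --> x.
    apply: Mcomplete; apply: cauchy_exP => r r0.
    have [n hn] := icauchy _ r0; exists (hm (q (i n))); exists n => // j /= nj.
    by rewrite ballEmdist; exact: hn.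
  have qlim : q (i j) @[j --> \oo] --> km x.
    have : km (hm (q (i j))) @[j --> \oo] --> km x by exact: cvg_comp xlim (ckm x).
    by under eq_fun do rewrite hmK.
  exists (km x) => //; apply/funext => s.
  have hE k : h s k = g s k (km x).
    apply: cvg_unique (gh s k) _ => //.
    exact: cvg_comp qlim ((gphi s).1 k (km x)).
  apply: cvg_unique ((gphi s).2 (km x)) _ => //.
  by have := hf s; under eq_fun do rewrite hE.
move=> [y _ <-].
have /choice[i iP] (j : nat) : exists n, mdist (hm y) (hm (q n)) < j.+1%:R^-1.
  have j0 : 0 < j.+1%:R^-1 :> R by [].
  have oV : open (hm @^-1` (ball (hm y) j.+1%:R^-1)°).
    by apply: open_comp => [x _|]; [exact: chm|exact: open_interior].
  have [|d [dV /qD[n qn]]] := dD _ _ oV.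
    by exists y; exact: nbhsx_ballx.
  exists n; rewrite qn.
  have := interior_subset dV; by rewrite ballEmdist.
have qlim : q (i j) @[j --> \oo] --> y.
  have hlim : hm (q (i j)) @[j --> \oo] --> hm y.
    move=> A /nbhs_ballP[r /= r0 rA]; have [n hn] := inv_small _ r0.
    exists n => // j /= nj; apply: rA; rewrite ballEmdist /=.
    exact: lt_trans (iP j) (hn _ nj).
  have : km (hm (q (i j))) @[j --> \oo] --> km (hm y) by exact: cvg_comp hlim (ckm _).
  by rewrite hmK; under eq_fun do rewrite hmK.
exists i, (fun s k => g s k y); split.
- move=> r r0; have r20 : 0 < r / 2 by rewrite divr_gt0.
  have [n hn] := inv_small _ r20; exists n => j k nj nk /=.
  apply: le_lt_trans (metric_triangle _ (hm y) _) _; rewrite (splitr r).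
  rewrite metric_sym; apply: ltrD; first exact: lt_trans (iP j) (hn _ nj).
  exact: lt_trans (iP k) (hn _ nk).
- by move=> s k; exact: cvg_comp qlim ((gphi s).1 k y).
- by move=> s; exact: (gphi s).2.
Qed.

Section SplitNotRosenthal.
Context (R : realType) (P : (nat -> bool) -> nat -> bool).
Context (X : topologicalType).
Context (pt : (nat -> bool) * bool -> X) (co : X -> (nat -> bool) * bool).
Hypothesis ptK : cancel pt co.
Hypothesis nbhsX : forall x A,
  nbhs x A <-> exists n, split_nbhs P n (co x) `<=` pt @^-1` A.
Hypothesis P_unbounded : forall t b, unbounded [set n | P t n = b].
Hypothesis P_unpredicted : forall v, exists t,
  ~ predicted_pattern (@coded_family R v) t (P t).

Lemma split_not_rosenthal : ~ rosenthal_compact R X.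
Proof.
move=> [Y [C [pY _ Cbaire [h [k [ch ck hK kK]]]]]].
pose ev (y : Y) (x : X) : R := set_val (h x) y.
have ev_continuous y : continuous (ev y).
  move=> x; have cv : continuous (set_val : set_type C -> {ptws Y -> R}).
    exact: initial_continuous.
  have hx : (set_val \o h) z @[z --> x] --> (set_val (h x) : {ptws Y -> R}).
    exact: continuous_comp (ch x) (cv (h x)).
  have := (pointwise_cvgP (set_val (h x)) _).1 hx y.
  exact.
have sep t : exists y, ev y (pt (t, true)) <> ev y (pt (t, false)).
  apply: contrapT => /forallNP same.
  have : h (pt (t, true)) = h (pt (t, false)).
    by apply: val_inj; apply/funext => y; exact: contrapT (same y).
  by move=> /(can_inj hK)/(can_inj ptK).
have [y0 _] := sep xpredT.
have [|v vE] := @polish_coded_family R Y (fun s y => ev y (pt (dyadic s, false))) y0 pY.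
  by move=> s; apply: Cbaire; exact: set_valP.
have [t] := P_unpredicted v; apply.
exact: (coded_family_predicted ptK nbhsX P_unbounded ev_continuous (sep t) vE).
Qed.

End SplitNotRosenthal.

Lemma well_order_refl {A : Type} {le : rel A} : well_order le -> forall a, le a a.
Proof.
move=> wo a; have [|z [[/asboolP -> zmin] _]] := wo [pred x | `[< x = a >]].
  by exists a; exact/asboolP.
by apply: zmin; exact/asboolP.
Qed.

Lemma well_order_antisym {A : Type} {le : rel A} : well_order le ->
  forall a b, le a b -> le b a -> a = b.
Proof.
move=> wo a b ab ba.
have [|z [_ zuniq]] := wo [pred x | `[< x = a \/ x = b >]].
  by exists a; apply/asboolP; left.
have zE c : c = a \/ c = b -> le c a -> le c b -> z = c.
  move=> cab ca cb; apply: zuniq; split=> [|y /asboolP[]->//].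
  exact/asboolP.
have refl := well_order_refl wo.
by rewrite -(zE a (or_introl erefl) (refl a) ab); apply: zE => //; right.
Qed.

Lemma well_order_olt_trans {A : Type} {le : rel A} : well_order le ->
  forall a b c, olt le a b -> olt le b c -> olt le a c.
Proof.
move=> wo a b c ab bc.
have asym x y : olt le x y -> olt le y x -> False.
  by move=> [xy xny] [yx _]; apply: xny; exact: well_order_antisym xy yx.
case: (well_order_total wo a c) => // [ca|ac]; last by rewrite ac in ab; case: (asym _ _ ab bc).
have [|z [[/asboolP zE zmin] _]] := wo [pred x | `[< [\/ x = a, x = b | x = c] >]].
  by exists a; apply/asboolP; constructor 1.
have lez x : [\/ x = a, x = b | x = c] -> olt le x z -> False.
  by move=> /asboolP/zmin zx [xz]; apply; exact: well_order_antisym xz zx.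
exfalso; case: zE lez => -> lez.
- by apply: (lez c) => //; constructor 3.
- by apply: (lez a) => //; constructor 1.
- by apply: (lez b) => //; constructor 2.
Qed.

Section Omega.
Context (W : Type) (leW : rel W) (omega1W : is_omega1 leW).

Lemma omega1_succ a : exists b,
  [set x | olt leW x b] = [set x | olt leW x a] `|` [set a].
Proof.
have [wo unc ctb] := omega1W.
have [|b [[/asboolP ab bmin] _]] := wo [pred x | `[< olt leW a x >]].
  apply: contrapT => h; apply: unc.
  apply: (@countableS _ _ ([set x | olt leW x a] `|` [set a])).
    move=> x _; case: (well_order_total wo x a) => [|ax|]; [by left| |by right].
    by case: h; exists x; exact/asboolP.
  by apply: countable_setU => //; exact: countable1.
exists b; apply/seteqP; split=> x; last first.
  by move=> [xa|->//]; exact: well_order_olt_trans xa ab.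
move=> [xb xnb]; case: (well_order_total wo x a) => [|ax|]; [by left| |by right].
by case: xnb; apply: (well_order_antisym wo) => //; apply: bmin; exact/asboolP.
Qed.

Lemma omega1_nth : exists s : nat -> W,
  (forall n, is_nth leW n (s n)) /\ forall n a, is_nth leW n a -> range s a.
Proof.
have [wo unc ctb] := omega1W.
have [z z0] : exists z, [set x | olt leW x z] = set0.
  have [w0 _] : exists w : W, True.
    apply: contrapT => h; apply: unc. rewrite (_ : setT = set0).
      exact: countable0.
    by rewrite -subset0 => w _; apply: h; exists w.
  have [|z [[_ zmin] _]] := wo xpredT; first by exists w0.
  exists z; rewrite -subset0 => x [xz]; apply.
  by apply: (well_order_antisym wo) => //; exact: zmin.
have /choice[sc scP] := omega1_succ.
pose s n := iter n sc z.
have sE n : [set x | olt leW x (s n)] = s @` `I_n.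
  elim: n => [|n IH]; first by rewrite /= z0 II0 image_set0.
  by rewrite /= scP IH IIS image_setU image_set1.
have sI : injective s.
  have lt m n : (m < n)%N -> s m <> s n.
    move=> mn; have : (s @` `I_n) (s m) by exists m.
    by rewrite -sE => -[].
  move=> m n smn; have [mn|nm|//] := ltngtP m n; first by case: (lt _ _ mn).
  by case: (lt _ _ nm).
exists s; split=> [n|n a na].
  by rewrite /is_nth sE; apply: inj_card_eq => x y _ _; exact: sI.
apply: contrapT => nsa.
have sa m : olt leW (s m) a.
  case: (well_order_total wo (s m) a) => // [am|ma]; last first.
    by case: nsa; exists m.
  by have : (s @` `I_m) a; [rewrite -sE|move=> [k _ ka]; case: nsa; exists k].
have : finite_set (range s).
  have sub : range s `<=` [set x | olt leW x a] by move=> _ [m _ <-]; exact: sa.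
  by apply: sub_finite_set sub _; exists n.
apply/infiniteP; have /card_eqPle[] // : range s #= [set: nat].
by apply: inj_card_eq => x y _ _; exact: sI.
Qed.

Lemma is_nth_unique m n a : is_nth leW m a -> is_nth leW n a -> m = n.
Proof.
rewrite /is_nth card_eq_sym => am an.
by apply/card_eq_II; exact: card_eq_trans am an.
Qed.

Lemma CH_coordinates : CH -> exists psi : W -> nat -> bool,
  forall t, exists2 a, ~ (exists n, is_nth leW n a) & psi a = t.
Proof.
move=> ch; have /card_set_bijP[f [_ _ fS]] : [set: W] #= [set: nat -> bool].
  by rewrite card_eq_sym; exact: ch omega1W.
exists (fun a n => f a n.*2) => t.
apply: contrapT => h; apply: nat_bool_uncountable.
have [s [_ sP]] := omega1_nth.
apply: (@countableS _ _ ((fun a n => f a n.*2.+1) @` range s)); last first.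
  by do 2!apply: countable_image; exact: countableP.
move=> u _; pose v n := if odd n then u n./2 else t n./2.
have [a _ av] := fS v I.
exists a; last first.
  by rewrite av; apply/funext => n; rewrite /v /= odd_double /= uphalf_double.
have [n na] : exists n, is_nth leW n a; last exact: sP na.
apply: contrapT => na; apply: h; exists a => //.
by rewrite av; apply/funext => n; rewrite /v odd_double doubleK.
Qed.

End Omega.

Section Embedding.
Context (W : Type) (leW : rel W) (omega1W : is_omega1 leW).
Context (psi : W -> nat -> bool).
Hypothesis psi_surj :
  forall t, exists2 a, ~ (exists n, is_nth leW n a) & psi a = t.
Context (P : (nat -> bool) -> nat -> bool).

Definition split_embed (x : (nat -> bool) * bool) : {ptws W -> bool} :=
  fun a => if pselect (exists n, is_nth leW n a) is left h
    then x.1 (projT1 (cid h)) else side P (psi a) x.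

Lemma split_embed_nth x n a : is_nth leW n a -> split_embed x a = x.1 n.
Proof.
move=> na; rewrite /split_embed; case: pselect => [h|[]]; last by exists n.
by case: cid => m /= ma; rewrite (is_nth_unique ma na).
Qed.

Lemma split_embed_side x a : ~ (exists n, is_nth leW n a) ->
  split_embed x a = side P (psi a) x.
Proof. by move=> na; rewrite /split_embed; case: pselect. Qed.

Lemma split_embed_fst x (s : nat -> bool) :
  restr_omega leW (split_embed x) s -> x.1 = s.
Proof.
move=> xs; apply/funext => n; have [w [wn _]] := omega1_nth omega1W.
by rewrite -(xs _ _ (wn n)) (split_embed_nth _ (wn n)).
Qed.

Lemma split_embed_inj : injective split_embed.
Proof.
move=> x y xy.
have xy1 : x.1 = y.1.
  by apply: split_embed_fst => n a na; rewrite xy (split_embed_nth _ na).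
have [a na ax] := psi_surj x.1.
have := congr1 (fun g => g a) xy; rewrite !split_embed_side// ax side_fst xy1.
rewrite side_fst => xy2.
by rewrite [LHS]surjective_pairing [RHS]surjective_pairing xy1 xy2.
Qed.

Definition split_space : set {ptws W -> bool} := range split_embed.

Definition split_point (x : (nat -> bool) * bool) : set_type split_space :=
  SigSub (mem_set (imageT split_embed x)).

Definition split_coord (y : set_type split_space) : (nat -> bool) * bool :=
  projT1 (cid2 (set_valP y)).

Lemma split_coordK : cancel split_coord split_point.
Proof.
by move=> y; apply: val_inj => /=; rewrite /split_coord; case: cid2.
Qed.

Lemma split_pointK : cancel split_point split_coord.
Proof.
move=> x; apply: split_embed_inj.
by have := congr1 val (split_coordK (split_point x)).
Qed.

Lemma split_embed_near x a :
  exists n, forall y, split_nbhs P n x y -> split_embed y a = split_embed x a.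
Proof.
have [[n na]|na] := pselect (exists n, is_nth leW n a).
  by exists n.+1 => y [yx _]; rewrite !(split_embed_nth _ na) yx.
have [xa|xa] := pselect (x.1 = psi a).
  exists 0%N => y [_ yx]; rewrite !split_embed_side// -xa yx.
  by rewrite side_fst.
exists (Delta x.1 (psi a)).+1 => y [yx _].
have [ya yE] := Delta_agree xa yx.
by rewrite !split_embed_side// !side_neq// yE.
Qed.

Lemma split_embed_cvg x (V : set {ptws W -> bool}) :
  nbhs (split_embed x) V -> exists n, split_nbhs P n x `<=` split_embed @^-1` V.
Proof.
pose F := filter_from setT (fun n => split_nbhs P n x).
have FF : Filter F.
  apply: filter_from_filter; first by exists 0%N.
  move=> m n _ _; exists (maxn m n) => // y yx.
  by split; apply: split_nbhs_le yx; rewrite ?leq_maxl ?leq_maxr.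
have cF : fmap split_embed F --> (split_embed x : {ptws W -> bool}).
  apply/cvg_sup => a A [_ [[B oB <-] Bx BA]].
  have [n hn] := split_embed_near x a; exists n => // y /hn yx.
  by apply: BA; rewrite /= yx.
by move=> /cF[n _ nV]; exists n.
Qed.

Lemma split_space_nbhs y (A : set (set_type split_space)) :
  nbhs y A <-> exists n, split_nbhs P n (split_coord y) `<=` split_point @^-1` A.
Proof.
split=> [|[n nA]].
  move=> [_ [[V oV <-] Vy VA]].
  have [|n nV] := @split_embed_cvg (split_coord y) V.
    apply: open_nbhs_nbhs; split=> //.
    by have -> : split_embed (split_coord y) = val y by rewrite -[in RHS](split_coordK y).
  by exists n => z /nV Vz; exact: VA.
have valE z : val z = split_embed (split_coord z).
  by rewrite -[in LHS](split_coordK z).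
have cv a : nbhs y [set z : set_type split_space | val z a = val y a].
  have cproj : continuous (fun z : set_type split_space => val z a).
    have c1 : continuous (val : set_type split_space -> {ptws W -> bool}).
      exact: initial_continuous.
    have c2 : continuous (fun g : {ptws W -> bool} => g a).
      exact: (@proj_continuous {classic W} (fun=> bool) a).
    by move=> z; apply: continuous_comp (c1 z) (c2 (val z)).
  have : nbhs (val y a) [set val y a] by [].
  by move=> /cproj.
have [s [sn _]] := omega1_nth omega1W.
have [a na ax] := psi_surj (split_coord y).1.
have near_n m : nbhs y [set z : set_type split_space |
    agree m (split_coord z).1 (split_coord y).1].
  elim: m => [|m IH]; first by apply: filterS filterT => z _ [].
  apply: filterS (filterI IH (cv (s m))) => z [/= zm zs] k.
  rewrite ltnS leq_eqVlt => /predU1P[->|]; last exact: zm.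
  by move: zs; rewrite !valE !(split_embed_nth _ (sn m)).
apply: filterS (filterI (near_n n) (cv a)) => z [zn /= za].
have := nA (split_coord z); rewrite /= split_coordK; apply; split=> //.
by move: za; rewrite !valE !split_embed_side// ax side_fst.
Qed.

End Embedding.

Section Construction.
Context (R : realType) (W : Type) (leW : rel W) (omega1W : is_omega1 leW).
Context (ch : CH).

Let predicted (o t : nat -> bool) : nat -> bool :=
  xget (fun=> true)
    [set Q | predicted_pattern (@coded_family R (@decode_reals R _ o)) t Q].

Let decode_seq (o : nat -> bool) (k n : nat) : bool := o (pickle (k, n)).

Lemma CH_splitting : exists P : (nat -> bool) -> nat -> bool,
  [/\ forall t b, unbounded [set n | P t n = b],
      forall S : nat -> nat -> bool,
        countable [set t | ~ (unbounded (accumulation_levels S t) -> forall b,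
          unbounded [set n | accumulation_levels S t n /\ P t n = b])] &
      forall v, exists t, ~ predicted_pattern (@coded_family R v) t (P t)].
Proof.
pose J (o : nat -> bool) (k : nat) (t : nat -> bool) : set nat :=
  if (k < 2)%N then accumulation_levels (decode_seq o) t else setT.
pose B (o : nat -> bool) (k : nat) (t : nat -> bool) (n : nat) : bool :=
  if (k < 2)%N then k == 1%N else predicted o t n (+) (k == 3)%N.
have [P [P_unbounded P_ctb]] := CH_diagonal omega1W ch J B.
exists P; split=> // [S|v].
- pose o n := if unpickle n is Some p then S p.1 p.2 else false.
  have oS : decode_seq o = S.
    by apply/funext => k; apply/funext => n; rewrite /decode_seq /o pickleK.
  apply: countableS (P_ctb o) => t /= tS; apply: contra_not tS => tJ uS b.
  have := tJ (b : nat); rewrite /J /B oS (_ : (b < 2)%N); last by case: (b).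
  by move=> /(_ uS); apply: unbounded_subset => n []; case: (b).
- have [w <-] := @decode_reals_surj R code_index v.
  have [t tJ] : exists t, forall k, unbounded (J w k t) ->
      unbounded [set n | J w k t n /\ P t n = B w k t n].
    apply: contrapT => h; apply: nat_bool_uncountable.
    by apply: countableS (P_ctb w) => t _ /= tJ; apply: h; exists t.
  exists t => PtP.
  have /predicted_pattern_unique/(_ PtP)[c] :
      predicted_pattern (@coded_family R (decode_reals R w)) t (predicted w t).
    by rewrite /predicted; case: xgetP => [Q _ //|/(_ (P t))].
  apply; have := tJ (2 + c)%N unboundedT.
  by apply: unbounded_subset => n [_ Ptn] /=; rewrite Ptn /B; case: (c).
Qed.

End Construction.

Theorem theorem3p1 (R : realType) (W : Type) (leW : rel W)
    (omega1W : is_omega1 leW) (ch : CH) :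
  exists (K : set {ptws W -> bool}) (cK : compact [set: set_type K]),
    (~ metrizable R (set_type K) /\
     two_to_one_preimage_of_metric R (set_type K)) /\
    (hereditarily separable_space (set_type K) /\
     hereditarily lindelof_space (set_type K)) /\
    all_radon_separable R (set_type K) /\
    isolated [set: set_type K] = set0 /\
    ~ rosenthal_compact R (set_type K) /\
    (forall (A : Type) (leA : rel A)
        (f : A -> Cspace R cK) (phi : A -> dual (Cspace R cK))
        (x0 x1 : A -> set_type K),
      well_order leA -> ~ countable [set: A] ->
      semi_biorthogonal leA f phi -> nice_witness phi x0 x1 ->
      omega_determined leW x0 x1).
Proof.
have [P [P_unbounded P_splits P_unpredicted]] := CH_splitting R omega1W ch.
have [psi psi_surj] := CH_coordinates omega1W ch.
pose pt := split_point leW psi P.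
pose co := @split_coord W leW psi P.
have ptK : cancel pt co := split_pointK omega1W psi_surj P.
have coK : cancel co pt := @split_coordK W leW psi P.
have nb := @split_space_nbhs W leW omega1W psi psi_surj P.
exists (split_space leW psi P), (split_compact ptK coK nb).
split; [split|split; [split|split; [|split; [|split]]]].
- exact: (split_not_metrizable ptK nb P_splits).
- exact: (split_two_to_one R ptK coK nb).
- exact: (split_hereditarily_separable ptK coK nb P_splits).
- exact: (split_hereditarily_lindelof ptK coK nb P_splits).
- exact: (@split_radon_separable R _ _ _ _ ptK coK nb P_splits).
- exact: (split_isolated ptK nb P_unbounded).
- exact: (split_not_rosenthal ptK nb P_unbounded P_unpredicted).
move=> A leA f phi x0 x1 wo _ [phi1 phi0 _] xphi s.
have coE (y : set_type (split_space leW psi P)) :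
    restr_omega leW (val y) s -> (co y).1 = s.
  move=> ys; apply: (split_embed_fst omega1W (psi := psi) (P := P)).
  by rewrite -[y]coK in ys.
have x01 a : x0 a <> x1 a.
  move=> e; have := congr1 (fun g => g (f a)) (xphi a).
  by rewrite /= /delta e phi1 subrr => /eqP; rewrite oner_eq0.
apply/countable_injP; exists (fun a => (co (x1 a)).2 : nat) => a b.
rewrite !inE => -[/coE a0 /coE a1] [/coE b0 /coE b1] /= ab2.
have snd_neq c : (co (x0 c)).1 = s -> (co (x1 c)).1 = s ->
    (co (x0 c)).2 = ~~ (co (x1 c)).2.
  move=> c0 c1; have : (co (x0 c)).2 <> (co (x1 c)).2.
    move=> c2; apply: (x01 c); apply: (can_inj coK).
    by rewrite [LHS]surjective_pairing [RHS]surjective_pairing c0 c1 c2.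
  by case: (co (x0 c)).2; case: (co (x1 c)).2.
have ab1 : (co (x1 a)).2 = (co (x1 b)).2.
  by move: ab2; case: (co (x1 a)).2; case: (co (x1 b)).2.
have x1E : x1 a = x1 b.
  apply: (can_inj coK).
  by rewrite [LHS]surjective_pairing [RHS]surjective_pairing a1 b1 ab1.
have x0E : x0 a = x0 b.
  apply: (can_inj coK); rewrite [LHS]surjective_pairing [RHS]surjective_pairing.
  by rewrite a0 b0 !snd_neq// ab1.
have same c d : olt leA c d -> x0 c = x0 d -> x1 c = x1 d -> False.
  move=> cd e0 e1; have := phi0 _ _ cd.
  have -> : phi d (f c) = phi c (f c).
    by have := xphi d; have := xphi c; rewrite e0 e1 => <- ->.
  by rewrite phi1 => /eqP; rewrite oner_eq0.
case: (well_order_total wo a b) => // h.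
  by case: (same _ _ h).
by case: (same _ _ h).
Qed.
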